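(* Let $n\ge2$. If $n$ is a power of $2$, then $$C_n^{\mathrm{udr}}\left(\frac{2t}{1+t^2}\right)=\frac{2}{n(1+t^2)^n(1+t)^2}\left(2^nA_n(t^2)+tB_n(t^2)-t(1-t^2)^n\right);$$ otherwise, $$C_n^{\mathrm{udr}}\left(\frac{2t}{1+t^2}\right)=\frac{2}{n(1+t^2)^n(1+t)^2}\sum_{\substack{d\mid n\\ d\text{ odd}}}\mu(d)(1-t^2)^{n-n/d}\left(2^{n/d}A_{n/d}(t^2)+tB_{n/d}(t^2)\right).$$
   Context: For a permutation $\pi=\pi(1)\cdots\pi(n)$ of $[n]=\{1,\dots,n\}$, a birun is a maximal monotone consecutive subsequence of $\pi$, and an up-down run is a birun of $\pi$, or the single letter $\pi(1)$ if $\pi(1)>\pi(2)$; $\mathrm{udr}(\pi)$ is the number of up-down runs (e.g. $71462853$ has up-down runs $7,71,146,62,28,853$). $\mathfrak{C}_n$ is the set of cyclic permutations of $[n]$ (those consisting of a single cycle of length $n$), and $C_n^{\mathrm{udr}}(t)=\sum_{\pi\in\mathfrak{C}_n}t^{\mathrm{udr}(\pi)}$. Eulerian polynomials: $A_n(t)=\sum_{\pi\in\mathfrak{S}_n}t^{\mathrm{des}(\pi)+1}$ for $n\ge1$, where $\mathfrak{S}_n$ is the set of permutations of $[n]$ and $\mathrm{des}(\pi)$ is the number of $i\in[n-1]$ with $\pi(i)>\pi(i+1)$. Type B Eulerian polynomials: $\frac{B_n(t)}{(1-t)^{n+1}}=\sum_{k=0}^\infty(2k+1)^nt^k$. $\mu$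 is the number-theoretic Möbius function. *)

(* Defs.v *)
From mathcomp Require Import all_boot all_order all_fingroup all_algebra.
From mathcomp Require Import ring.

Set Implicit Arguments.
Unset Strict Implicit.
Unset Printing Implicit Defensive.

Import GRing.Theory.

Local Open Scope nat_scope.

(* A permutation of {1, ..., n} is an element of 'S_n: positions and letters
   are both shifted down by 1. A consecutive subsequence s i, ..., s j of the
   one-line notation is represented by the pair (i, j) of its end positions. *)

Definition monotone_seg n (s : 'S_n) (I : 'I_n * 'I_n) : bool :=
  [forall a : 'I_n, forall b : 'I_n,
     [&& I.1 <= a, a < b & b <= I.2] ==> (s a < s b)]
  || [forall a : 'I_n, forall b : 'I_n,
     [&& I.1 <= a, a < b & b <= I.2] ==> (s b < s a)].

Definition is_birun n (s : 'S_n) (I : 'I_n * 'I_n) : bool :=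
  [&& I.1 <= I.2, monotone_seg s I
    & [forall J : 'I_n * 'I_n,
         [&& J.1 <= I.1, I.2 <= J.2 & monotone_seg s J] ==> (J == I)]].

Definition descent_at n (s : 'S_n) (i : 'I_n) : bool :=
  [exists j : 'I_n, (j == i.+1 :> nat) && (s j < s i)].

(* The single letter s 0 is the pair (0, 0), which is not a birun when n >= 2. *)
Definition is_updown_run n (s : 'S_n) (I : 'I_n * 'I_n) : bool :=
  is_birun s I
  || [&& I.1 == 0 :> nat, I.2 == 0 :> nat & descent_at s I.1].

Definition udr n (s : 'S_n) : nat := #|[set I | is_updown_run s I]|.

Definition des n (s : 'S_n) : nat := #|[set i | descent_at s i]|.

Definition cyclic_perm n (s : 'S_n) : bool := porbits s == [set [set: 'I_n]].

Definition mobius (d : nat) : int :=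
  if (0 < d) && all (fun p => logn p d == 1) (primes d)
  then ((-1) ^+ size (primes d))%R else 0%R.

Definition pow2 (n : nat) : Prop := exists k : nat, n = 2 ^ k.

Local Open Scope ring_scope.

Definition cyclic_udr_poly (R : comNzRingType) (n : nat) : {poly R} :=
  \sum_(s : 'S_n | cyclic_perm s) 'X^(udr s).

Definition eulerian (R : comNzRingType) (n : nat) : {poly R} :=
  \sum_(s : 'S_n) 'X^((des s).+1).

(* Coefficient m of the formal power series
   (1 - t)^(n+1) * \sum_(k >= 0) (2k+1)^n t^k. *)
Definition typeB_coef (R : comNzRingType) (n m : nat) : R :=
  \sum_(i < m.+1) ((1 - 'X : {poly R}) ^+ n.+1)`_i * ((m - i).*2.+1 ^ n)%:R.

(* The truncation at degree n loses nothing, see coef_typeB_eulerian. *)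
Definition typeB_eulerian (R : comNzRingType) (n : nat) : {poly R} :=
  \poly_(m < n.+1) typeB_coef R n m.

Lemma coef_1subX_exp (R : comNzRingType) (N i : nat) :
  ((1 - 'X : {poly R}) ^+ N)`_i = (-1) ^+ i * 'C(N, i)%:R.
Proof.
rewrite exprBn coef_sum.
under eq_bigr => j _.
  rewrite expr1n mulr1 coefMn -signr_odd.
  rewrite (_ : ((-1) ^+ odd j * 'X^j : {poly R})`_i = (-1) ^+ j * (i == j)%:R).
    over.
  by rewrite -[in RHS]signr_odd; case: (odd j);
    rewrite ?expr1 ?expr0 ?mulN1r ?mul1r ?coefN coefXn.
case: (ltnP i N.+1) => iN.
  rewrite (bigD1 (Ordinal iN)) //= eqxx mulr1 mulr_natr big1 ?addr0 // => j.
  rewrite -val_eqE /= eq_sym => /negPf ->.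
  by rewrite mulr0 mul0rn.
rewrite bin_small // mulr0 big1 // => j _.
have -> : (i == j) = false by apply/gtn_eqF; exact: leq_trans (ltn_ord j) iN.
by rewrite mulr0 mul0rn.
Qed.

Lemma alternating_sum_eq0 (R : comNzRingType) (n m : nat) (x : R) :
  (n < m)%N ->
  \sum_(i < m.+1) (-1) ^+ i * 'C(m, i)%:R * (x - i.*2%:R) ^+ n = 0.
Proof.
elim: n m x => [|n IHn] m x nm.
  transitivity ((1 - 1 : R) ^+ m); last by rewrite subrr expr0n gtn_eqF.
  rewrite exprBn; apply: eq_bigr => i _.
  by rewrite expr0 !expr1n !mulr1 mulr_natr.
case: m nm => // m nm.
rewrite (eq_bigr (fun i : 'I_m.+2 =>
  x * ((-1) ^+ i * 'C(m.+1, i)%:R * (x - i.*2%:R) ^+ n)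
  - (-1) ^+ i * ('C(m.+1, i)%:R * i.*2%:R) * (x - i.*2%:R) ^+ n)); last first.
  by move=> i _; rewrite exprS; ring.
rewrite sumrB -mulr_sumr IHn ?(ltn_trans _ nm) // mulr0 sub0r.
rewrite big_ord_recl /= mulr0 mulr0 mul0r add0r.
rewrite (eq_bigr (fun i : 'I_m.+1 => - (m.+1.*2%:R) *
  ((-1) ^+ i * 'C(m, i)%:R * (x - 2%:R - i.*2%:R) ^+ n))); last first.
  move=> i _; rewrite /bump /= add1n exprS.
  have -> : 'C(m.+1, i.+1)%:R * i.+1.*2%:R = m.+1.*2%:R * 'C(m, i)%:R :> R.
    by rewrite -!natrM -!muln2 mulnC mulnAC -mul_bin_diag /= mulnAC.
  have -> : i.+1.*2%:R = 2%:R + i.*2%:R :> R by rewrite doubleS -natrD.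
  rewrite opprD addrA; move: (_ ^+ n) (_ ^+ i) => y z.
  move: m.+1.*2%:R 'C(m, i)%:R => a b.
  ring.
by rewrite -mulr_sumr IHn // mulr0 oppr0.
Qed.

Lemma coef_typeB_eulerian (R : comNzRingType) (n m : nat) :
  (typeB_eulerian R n)`_m = typeB_coef R n m.
Proof.
rewrite coef_poly; case: ltnP => // nm.
pose f i : R := (-1) ^+ i * 'C(n.+1, i)%:R * (m.*2.+1%:R - i.*2%:R) ^+ n.
transitivity (\sum_(i < n.+2) f i); first by rewrite alternating_sum_eq0.
rewrite (big_ord_widen m.+1 f) // big_mkcond /=.
apply: eq_bigr => i _; rewrite coef_1subX_exp /f.
case: ltnP => iN; last by rewrite bin_small // mulr0 mul0r.
have im : (i <= m)%N by rewrite -ltnS.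
congr (_ * _); rewrite natrX -natrB ?doubleB; last first.
  by rewrite leqW // leq_double.
by rewrite subSn // leq_double.
Qed.

(* Main.v *)
Require Import Defs.
From mathcomp Require Import all_boot all_order all_fingroup all_algebra.
From mathcomp Require Import zify ring.

(** Give the letters 0, 1, 2, ... alternating signs, the odd ones being
    negative. For a permutation [s] of n positions, let c_m(s) be the number of
    weakly increasing words f of length n over the first m letters such that
    f i = f (i+1) forces an ascent of [s] at i when the repeated letter is
    positive and a descent when it is negative (predicate [fits]). The theorem
    comes from computing the sum of c_m(s) over all cyclic [s] in two ways.

    For fixed [s], build f one position at a time. Each new position multiplies
    the generating function over the last letter by (1+x^2)/(1-x^2) if [s] keeps
    its direction and by 2x/(1-x^2) if it turns ([fits_series_step]). Since
    udr(s) is one more than the number of turns, where [s] is regarded as rising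
    before its first letter ([udr_changes]), this gives
      sum_m c_m(s) x^m
        = x (1+x)^2 (2x)^(udr(s)-1) (1+x^2)^(n-udr(s)) / (1-x^2)^(n+1),
    which is why 2t/(1+t^2) is the right substitution
    ([cyclic_udr_poly_from_counts]).

    For fixed m, the words are counted by a signed form of the
    Gessel-Reutenauer correspondence. A cyclic permutation with a marked
    position is the cyclic shift transported along a bijection from Z/n to the
    positions, so that pairs of a cyclic [s] and a word fitting it, with a marked
    position, are the same as pairs of a circular word w and an order on its n
    places such that two places compare as their letters do and, when the letters
    agree, as their successors do, reversed if the letter is negative
    ([sum_cyclic_fits]). Such an order is a fixed point of a map which after n
    iterations only remembers the initial order of places with equal periodic
    readings; hence there is exactly one order if w is primitive, two if w is the
    square of a primitive word with an odd number of negative letters, and none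
    otherwise ([card_consistent]). Sorting all words by their minimal period
    yields, with G_m(n) = n * sum_s c_m(s),
      sum over odd d | n of G_m(n/d) = m^n - [n even][m odd]
    ([sum_cyclic_fits_count]). Moebius inversion over the odd divisors gives
    G_m(n). The correction term is multiplied by the sum of mu(d) over the odd
    divisors of n, which vanishes unless n is a power of 2.

    It remains to know the generating function of m^j. Its terms of even and of
    odd index are those of the Eulerian polynomials of types A and B taken at x^2
    ([mulps_power]), the former because the words of length j are counted by the
    same transfer argument with all letters positive ([sum_card_fits_pos]). *)

Set Implicit Arguments.
Unset Strict Implicit.
Unset Printing Implicit Defensive.

Import GRing.Theory.

Local Open Scope nat_scope.

(** * Multiplying formal power series by polynomials *)

Section PowerSeries.

Local Open Scope ring_scope.

Variable R : comNzRingType.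
Implicit Types (p q : {poly R}) (c : nat -> R).

(** The coefficient sequence of the product of the polynomial [p] and the formal
    power series with coefficients [c]. A rational series P/D is handled below
    through the identity saying that multiplying its coefficients by D gives the
    coefficients of P. *)
Definition mulps p c (m : nat) : R := \sum_(i < m.+1) p`_i * c (m - i)%N.

Lemma mulps_coefM N p c m :
  (m < N)%N -> mulps p c m = (p * \poly_(i < N) c i)`_m.
Proof.
move=> mN; rewrite coefM; apply: eq_bigr => i _.
by rewrite coef_poly (leq_ltn_trans (leq_subr _ _) mN).
Qed.

Lemma eq_mulps p c c' : c =1 c' -> mulps p c =1 mulps p c'.
Proof. by move=> eq_c m; apply: eq_bigr => i _; rewrite eq_c. Qed.

Lemma mulpsM p q c : mulps (p * q) c =1 mulps p (mulps q c).
Proof.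
move=> m; rewrite (mulps_coefM _ _ (ltnSn m)) -mulrA coefM.
apply: eq_bigr => i _; rewrite -mulps_coefM //.
by rewrite ltnS leq_subr.
Qed.

Lemma mulps_poly p q : mulps p (fun i => q`_i) =1 fun m => (p * q)`_m.
Proof. by move=> m; rewrite coefM. Qed.

Lemma mulpsC p q c : mulps p (mulps q c) =1 mulps q (mulps p c).
Proof. by move=> m; rewrite -!mulpsM mulrC. Qed.

Lemma mulpsD p q c m : mulps (p + q) c m = mulps p c m + mulps q c m.
Proof.
by rewrite -big_split; apply: eq_bigr => i _; rewrite coefD mulrDl.
Qed.

Lemma mulpsB p q c m : mulps (p - q) c m = mulps p c m - mulps q c m.
Proof.
by rewrite -sumrB; apply: eq_bigr => i _; rewrite coefB mulrBl.
Qed.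

Lemma mulpsXn k c m : mulps 'X^k c m = if (k <= m)%N then c (m - k)%N else 0.
Proof.
rewrite /mulps; case: ifP => [km|km].
  rewrite (bigD1 (Ordinal (km : k < m.+1)%N)) //= coefXn eqxx mul1r.
  rewrite big1 ?addr0 // => i; rewrite -val_eqE /= coefXn => /negPf ->.
  by rewrite mul0r.
rewrite big1 // => i _; rewrite coefXn.
suff -> : (i == k :> nat) = false by rewrite mul0r.
by apply/negP => /eqP ik; have := ltn_ord i; rewrite ik ltnS km.
Qed.

Lemma mul1ps c : mulps 1 c =1 c.
Proof. by move=> m; rewrite -[1](expr0 'X) mulpsXn /= subn0. Qed.

Lemma mulps_sumr (I : Type) (r : seq I) (P : pred I) p (c : I -> nat -> R) m :
  mulps p (fun k => \sum_(i <- r | P i) c i k) m = \sum_(i <- r | P i) mulps p (c i) m.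
Proof.
rewrite /mulps exchange_big /=; apply: eq_bigr => i _.
by rewrite mulr_sumr.
Qed.

Lemma mulpsZ p a c m : mulps p (fun k => a * c k) m = a * mulps p c m.
Proof. by rewrite /mulps mulr_sumr; apply: eq_bigr => i _; rewrite mulrCA. Qed.

Lemma mulps_partial_sum c m :
  mulps (1 - 'X) (fun k => \sum_(x < k) c x) m = mulps 'X c m.
Proof.
rewrite mulpsB mul1ps -['X]expr1 !mulpsXn; case: m => [|m].
  by rewrite big_ord0 subr0.
by rewrite big_ord_recr /= subn1 /= addrAC subrr add0r.
Qed.

(** A polynomial in x^2 acts separately on the terms of even and of odd index. *)
Lemma mulps_comp_sqr p c m :
  mulps (p \Po 'X^2) c m =
  mulps p (fun k => c (k.*2 + odd m)%N) m./2.
Proof.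
rewrite /mulps (eq_bigr (fun i : 'I_m.+1 =>
   if ~~ odd i then p`_i./2 * c (m - i)%N else 0)); last first.
  move=> i _; rewrite coef_comp_poly_Xn // dvdn2 divn2.
  by case: ifP; rewrite ?mul0r.
rewrite -big_mkcond /=.
rewrite (reindex_onto (fun i : 'I_m./2.+1 => inord i.*2 : 'I_m.+1)
   (fun i : 'I_m.+1 => inord i./2)); last first.
  move=> i ei; apply: val_inj; have := ltn_ord i; rewrite ltnS => im.
  rewrite /= !inordK ?ltnS //; lia.
apply: eq_big => [i|i].
  have := ltn_ord i; rewrite ltnS => im.
  rewrite inordK ?odd_double /=; last by rewrite ltnS; lia.
  apply/eqP; apply: val_inj; rewrite /= inordK; lia.
have := ltn_ord i; rewrite ltnS => im.
rewrite inordK; last by rewrite ltnS; lia.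
rewrite doubleK => _; congr (_ * c _); lia.
Qed.

End PowerSeries.

(** * The transfer argument for words fitting a sequence of directions *)

(** For the reversed list [ds] of the directions of a permutation ([true] for an
    ascent), this is the number of words fitting it whose last letter is [x]. A
    letter [x] may be repeated across a step [d] exactly when [d (+) neg x]. *)
Fixpoint fits_below (neg : pred nat) (ds : seq bool) (x : nat) : nat :=
  if ds is d :: ds' then
    \sum_(y < x) fits_below neg ds' y + (d (+) neg x) * fits_below neg ds' x
  else 1.

(** The default [true] in [head] makes a first step downwards count as a change
    of direction, as if the permutation came from below. *)
Fixpoint changes (ds : seq bool) : nat :=
  if ds is d :: ds' then (d != head true ds') + changes ds' else 0.

Lemma changes_size ds : changes ds <= size ds.
Proof. by elim: ds => //= d ds IH; rewrite -add1n leq_add ?leq_b1. Qed.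

Section Transfer.

Local Open Scope ring_scope.

Variable R : comNzRingType.

Definition fits_series neg ds (x : nat) : R := (fits_below neg ds x)%:R.

Definition total_series neg ds (k : nat) : R :=
  (\sum_(x < k) fits_below neg ds x)%:R.

Lemma total_seriesE neg ds :
  total_series neg ds =1 fun k => \sum_(x < k) fits_series neg ds x.
Proof. by move=> k; rewrite /total_series natr_sum. Qed.

Lemma fits_series_cons neg d ds x :
  fits_series neg (d :: ds) x =
  total_series neg ds x + (d (+) neg x)%:R * fits_series neg ds x.
Proof. by rewrite /fits_series /= natrD natrM. Qed.

Lemma total_seriesS neg ds k :
  total_series neg ds k.+1 = total_series neg ds k + fits_series neg ds k.
Proof. by rewrite /total_series big_ord_recr natrD. Qed.

Lemma total_series0 neg ds : total_series neg ds 0 = 0.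
Proof. by rewrite /total_series big_ord0. Qed.

(** When the last step is [d], letters whose parity is [d] cannot be repeated
    across it, while the letter just below can: both are then reached from the
    same letters. The sequence of counts is therefore constant on consecutive
    pairs of letters, the pairing being decided by [d]. *)
Definition paired (d : bool) (a : nat -> R) :=
  forall x, odd x == d -> a x = if x is y.+1 then a y else 0.

Lemma fits_series_paired ds : paired (head true ds) (fits_series odd ds).
Proof.
case: ds => [|d ds] x; first by case: x.
rewrite [head _ _]/= => /eqP <-.
rewrite fits_series_cons addbb mul0r addr0; case: x => [|x].
  by rewrite total_series0.
by rewrite fits_series_cons total_seriesS /= addNb addbb mul1r.
Qed.

(** Taking the difference of the counts for [x] and [x-2] removes the sum over
    smaller letters. The few terms left, on letters [x-2], [x-1] and [x], can be
    matched by pairing ([fits_series_paired]): a continued direction leaves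
    [x-2] and [x], a turn leaves twice [x-1]. *)
Lemma fits_series_step d ds :
  mulps (1 - 'X^2) (fits_series odd (d :: ds)) =1
  mulps (if d == head true ds then 1 + 'X^2 else 2 * 'X) (fits_series odd ds).
Proof.
move=> m; have P := fits_series_paired (ds := ds).
set a := fits_series odd ds in P *.
have -> : mulps (if d == head true ds then 1 + 'X^2 else 2 * 'X) a m =
   if d == head true ds then a m + (if (2 <= m)%N then a (m - 2)%N else 0)
   else 2 * (if (1 <= m)%N then a (m - 1)%N else 0).
  case: ifP => _; first by rewrite mulpsD mul1ps mulpsXn.
  by rewrite mulrC mulr_natr mulr2n mulpsD -['X]expr1 !mulpsXn mulr2n mulrDl mul1r.
rewrite mulpsB mul1ps mulpsXn.
case: m => [|[|m]] /=.
- rewrite fits_series_cons -/a total_series0 /= addbF subr0 !addr0 add0r.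
  have := P 0%N; rewrite -/a.
  by case: (head true ds); case: d => //= H0;
    first [ring | rewrite H0 //; ring].
- rewrite fits_series_cons -/a total_seriesS total_series0 /= subr0 add0r addr0 subnn.
  have := P 1%N; have := P 0%N; rewrite -/a.
  by case: (head true ds); case: d => //= H0 H1;
    first [ring | rewrite H0 //; ring | rewrite H1 //; ring | rewrite H1 // H0 //; ring].
- rewrite subn2 subn1 /= !fits_series_cons -/a !total_seriesS -/a /= negbK.
  have := P m.+2; have := P m.+1; rewrite /= -/a negbK.
  by case: (head true ds); case: d; case: (odd m) => //= H0 H1;
    first [ring | rewrite H0 //; ring | rewrite H1 //; ring | rewrite H1 // H0 //; ring].
Qed.

Lemma fits_series_odd ds :
  mulps ((1 - 'X^2) ^+ (size ds).+1) (fits_series odd ds) =1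
  fun m => ((1 + 'X) * (2 * 'X) ^+ changes ds
            * (1 + 'X^2) ^+ (size ds - changes ds))`_m.
Proof.
elim: ds => [|d ds IH] m.
  rewrite /= expr0 expr1 !mulr1 mulpsB mul1ps mulpsXn coefD coef1 coefX.
  by case: m => [|[|m]]; rewrite /fits_series /= ?subr0 ?addr0 ?add0r ?subrr.
rewrite exprSr mulpsM (eq_mulps _ (fits_series_step d ds)) mulpsC.
rewrite (eq_mulps _ IH) mulps_poly /=; apply: (congr1 (fun p : {poly R} => p`_m)).
have cs := changes_size ds.
case: eqP => _ /=; first by rewrite subSn // (exprS _ (_ - _)); ring.
by rewrite add1n subSS (exprS _ (changes _)); ring.
Qed.

(** Each of the steps contributes one factor; the two factors 1 + x come from
    the initial letter and from summing over the last letter. *)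
Lemma total_series_odd ds :
  mulps ((1 - 'X^2) ^+ (size ds).+2) (total_series odd ds) =1
  fun m => ('X * (1 + 'X) ^+ 2 * (2 * 'X) ^+ changes ds
            * (1 + 'X^2) ^+ (size ds - changes ds))`_m.
Proof.
move=> m; rewrite exprSr {2}(_ : 1 - 'X^2 = (1 + 'X) * (1 - 'X)); last by ring.
rewrite mulrA mulpsM (eq_mulps _ (eq_mulps _ (total_seriesE _ _))).
rewrite (eq_mulps _ (mulps_partial_sum _)) mulpsC mulrC.
rewrite (eq_mulps _ (mulpsM _ _ _)) (eq_mulps _ (eq_mulps _ (fits_series_odd _))).
rewrite (eq_mulps _ (mulps_poly _ _)) mulps_poly; apply: (congr1 (fun p : {poly R} => p`_m)); ring.
Qed.

(** With only positive letters, an ascent leaves no constraint beyond weak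
    increase and a descent forces strict increase, so that each descent
    contributes a factor x. This is the usual P-partition argument. *)
Lemma total_series_pos ds :
  mulps ((1 - 'X) ^+ (size ds).+2) (total_series pred0 ds) =1
  fun m => ('X ^+ (count negb ds).+1 : {poly R})`_m.
Proof.
move=> m; rewrite exprSr mulpsM (eq_mulps _ (eq_mulps _ (total_seriesE _ _))).
rewrite (eq_mulps _ (mulps_partial_sum _)) mulpsC (exprS 'X) -mulps_poly.
apply: eq_mulps; move: {m} ds; elim=> [|d ds IH] m.
  rewrite expr1 /= mulpsB mul1ps -['X]expr1 mulpsXn coef1.
  by case: m => [|m]; rewrite /fits_series /= ?subr0 ?subrr.
rewrite exprSr mulpsM /=; case: d => /=.
  rewrite add0n -IH; apply: eq_mulps => {}m.
  rewrite mulpsB mul1ps -['X]expr1 mulpsXn !fits_series_cons /= mul1r.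
  case: m => [|m]; first by rewrite total_series0 /= subr0 add0r.
  by rewrite subn1 /= mul1r total_seriesS addrAC subrr add0r.
rewrite add1n (exprS 'X) -mulps_poly -(eq_mulps _ IH) [RHS]mulpsC; apply: eq_mulps => {}m.
rewrite -(mulps_partial_sum _ m); apply: eq_mulps => {}m.
by rewrite fits_series_cons mul0r addr0 total_seriesE.
Qed.

End Transfer.

(** * Words fitting a permutation *)

(** The lexicographic order, with the order of second components reversed below
    a negative first component; it serves to compare pairs with distinct second
    components. *)
Definition tlex (neg : pred nat) : rel (nat * nat) := fun u v =>
  (u.1 < v.1) || (u.1 == v.1) && ((u.2 < v.2) (+) neg u.1).

Lemma tlex_trans neg : transitive (tlex neg).
Proof.
move=> [y b] [x a] [z c]; rewrite /tlex /= => H1 H2.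
have [xz|zx|xz] := ltngtP x z => //=.
  by move: H1 H2; case: ltngtP => //= ?; case: ltngtP => //= ?; lia.
move: H1 H2; rewrite xz; case: ltngtP => //= yz.
by rewrite yz; case: (neg z) => /=; rewrite ?addbT ?addbF; lia.
Qed.

(** Stated for all pairs of positions rather than adjacent ones; the two agree as
    [tlex] is transitive. *)
Definition fits neg n m (s : 'S_n) (f : {ffun 'I_n -> 'I_m}) : bool :=
  [forall i : 'I_n, forall j : 'I_n,
    (i < j) ==> tlex neg (val (f i), val (s i)) (val (f j), val (s j))].

Definition ascents n (s : 'S_n.+1) : seq bool :=
  mkseq (fun i => s (inord i) < s (inord i.+1)) n.

Lemma sum_tuple_cons (T : finType) n (g : seq T -> nat) :
  \sum_(w : n.+1.-tuple T) g w = \sum_(x : T) \sum_(w : n.-tuple T) g (x :: w).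
Proof.
rewrite pair_big /=.
rewrite (reindex (fun p : T * n.-tuple T => [tuple of p.1 :: p.2])) //=.
exists (fun w => (thead w, [tuple of behead w])) => [[x w] _|w _] /=.
  by congr (_, _); apply: val_inj.
by apply: val_inj; rewrite /= [in RHS](tuple_eta w).
Qed.

(** The word is read from its last letter backwards, so that the letters still
    to be chosen lie below [x] and the bound [m] disappears from the recursion. *)
Lemma sum_tuple_path neg m (x a : nat) (ps : seq nat) : x < m ->
  \sum_(w : (size ps).-tuple 'I_m)
     path (fun u v => tlex neg v u) (x, a) (zip (map val w) ps)
  = fits_below neg (pairmap (fun b c => c < b) a ps) x.
Proof.
elim: ps x a => [|b ps IH] x a xm.
  rewrite (eq_bigr (fun=> 1)) ?sum1_card ?card_tuple //= => w _.
  by rewrite (tuple0 w).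
rewrite (sum_tuple_cons _ (fun w : seq 'I_m =>
  nat_of_bool (path (fun u v => tlex neg v u) (x, a) (zip (map val w) (b :: ps))))) /=.
rewrite (eq_bigr (fun y : 'I_m => (y < x) * fits_below neg (pairmap (fun b c => c < b) b ps) y
  + (y == x :> nat) * (((b < a) (+) neg x) * fits_below neg (pairmap (fun b c => c < b) b ps) x))).
  rewrite big_split /=; congr (_ + _).
    rewrite (big_ord_widen m (fits_below neg _)) 1?ltnW // [RHS]big_mkcond /=.
    by apply: eq_bigr => y _; case: ifP => _; rewrite ?mul1n ?mul0n.
  rewrite (bigD1 (Ordinal xm)) //= eqxx mul1n big1 ?addn0 // => y.
  by rewrite -val_eqE /= => /negPf ->.
move=> y _; under eq_bigr => w _ do rewrite -mulnb.
rewrite -big_distrr /= IH ?ltn_ord //.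
by rewrite /tlex /=; case: ltngtP => //= [_|->]; rewrite ?mul1n ?mul0n ?addn0.
Qed.

(** By transitivity of [tlex], fitting is a condition on adjacent positions only,
    so the words can be counted one letter at a time. *)
Lemma card_fits neg n m (s : 'S_n.+1) :
  #|[set f : {ffun 'I_n.+1 -> 'I_m} | fits neg s f]|
  = \sum_(x < m) fits_below neg (rev (ascents s)) x.
Proof.
pose ps := rev [seq val (s i) | i <- enum 'I_n.+1].
have size_ps : size ps = n.+1 by rewrite size_rev size_map size_enum_ord.
have fitsE f : fits neg s f = sorted (fun u v => tlex neg v u)
    (zip (rev [seq val (f i) | i <- enum 'I_n.+1]) ps).
  rewrite -rev_zip ?size_map // rev_sorted zip_map.
  rewrite sorted_pairwise; last exact: tlex_trans.
  apply/forallP/(pairwiseP (0, 0)) => [H i j|H i].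
    rewrite -!topredE /= size_map size_enum_ord => ip jp ij.
    rewrite !(nth_map ord0) -?enumT ?size_enum_ord //.
    have /forallP/(_ (Ordinal jp))/implyP/(_ ij) := H (Ordinal ip).
    by rewrite (nth_ord_enum ord0 (Ordinal ip)) (nth_ord_enum ord0 (Ordinal jp)).
  apply/forallP => j; apply/implyP => ij.
  have := H i j; rewrite -!topredE /= size_map size_enum_ord !ltn_ord => /(_ isT isT ij).
  by rewrite !(nth_map ord0) -?enumT ?size_enum_ord // !nth_ord_enum.
have -> : #|[set f : {ffun 'I_n.+1 -> 'I_m} | fits neg s f]| =
   \sum_(w : (size ps).-tuple 'I_m) sorted (fun u v => tlex neg v u) (zip (map val w) ps).
  rewrite size_ps -sum1dep_card big_mkcond /=.
  rewrite (reindex (fun w : n.+1.-tuple 'I_m => [ffun i => tnth w (rev_ord i)])) /=.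
    apply: eq_bigr => w _; rewrite fitsE.
    suff -> : rev [seq val ([ffun i => tnth w (rev_ord i)] i) | i <- enum 'I_n.+1]
       = map val w by case: (sorted _ _).
    apply: (@eq_from_nth _ 0) => [|i].
      by rewrite size_rev !size_map -?enumT size_enum_ord size_tuple.
    rewrite size_rev size_map -?enumT size_enum_ord => ip.
    rewrite nth_rev ?size_map -?enumT ?size_enum_ord //.
    rewrite (nth_map ord0) -?enumT ?size_enum_ord ?ltn_subrL // ffunE.
    rewrite (nth_map (tnth w ord0)) ?size_tuple //; congr val.
    rewrite (tnth_nth (tnth w ord0)); congr nth.
    by rewrite /= nth_enum_ord ?ltn_subrL // !subSS subKn // -ltnS.
  exists (fun f : {ffun 'I_n.+1 -> 'I_m} => [tuple f (rev_ord i) | i < n.+1]).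
    by move=> w _; apply: eq_from_tnth => i; rewrite tnth_mktuple ffunE rev_ordK.
  by move=> f _; apply/ffunP => i; rewrite ffunE tnth_mktuple rev_ordK.
have {fitsE} : rev (ascents s) = pairmap (fun b c => c < b) (head 0 ps) (behead ps).
  apply: (@eq_from_nth _ false).
    by rewrite size_rev size_mkseq size_pairmap size_behead size_ps.
  move=> i; rewrite size_rev size_mkseq => ip.
  rewrite nth_rev ?size_mkseq // nth_mkseq ?ltn_subrL ?(leq_ltn_trans _ ip) //.
  rewrite (nth_pairmap 0) ?size_behead ?size_ps // nth_behead.
  have -> : head 0 ps :: behead ps = ps by move: size_ps; case: (ps).
  have nps k : k <= n -> nth 0 ps k = s (inord (n - k)).
    move=> kn; rewrite nth_rev ?size_map -?enumT ?size_enum_ord // subSS.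
    rewrite (nth_map ord0) -?enumT ?size_enum_ord ?ltnS ?leq_subr //.
    congr (val (s _)); apply: val_inj.
    by rewrite /= nth_enum_ord ?inordK ?ltnS ?leq_subr.
  by rewrite !nps ?(ltnW ip) // subnSK.
case: ps size_ps => //= a ps _ ->.
rewrite (sum_tuple_cons _ (fun w : seq 'I_m =>
  nat_of_bool (sorted (fun u v => tlex neg v u) (zip (map val w) (a :: ps))))) /=.
by apply: eq_bigr => x _; rewrite sum_tuple_path.
Qed.

(** * Up-down runs and changes of direction *)

Definition ascent_at n (s : 'S_n.+1) (i : nat) : bool :=
  s (inord i) < s (inord i.+1).

(** As in [changes], the permutation is taken to rise before position 0, so that
    position 0 is a turn when it is a descent. *)
Definition turn_at n (s : 'S_n.+1) (i : nat) : bool :=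
  ascent_at s i != (if i is j.+1 then ascent_at s j else true).

(** A segment is monotone when its adjacent steps all go in the same direction. *)
Lemma monotone_segP n (s : 'S_n.+1) (a b : 'I_n.+1) :
  reflect (exists d, forall i, a <= i < b -> ascent_at s i = d)
          (monotone_seg s (a, b)).
Proof.
have bn := ltn_ord b.
apply: (iffP orP) => [[/forallP H|/forallP H]|[[] H]].
- exists true => i /andP[ai ib]; have /forallP/(_ (inord i.+1)) := H (inord i).
  by rewrite /ascent_at /= !inordK ?ai ?ltnSn ?ib //=; lia.
- exists false => i /andP[ai ib]; have /forallP/(_ (inord i.+1)) := H (inord i).
  by rewrite /ascent_at /= !inordK ?ai ?ltnSn ?ib //=; lia.
- left; apply/forallP => x; apply/forallP => y; apply/implyP => /and3P[/= ax xy yb].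
  have [k yE] : exists k, y = (x + k).+1 :> nat by exists (y - x.+1); lia.
  have -> : y = inord (x + k).+1 by rewrite -yE inord_val.
  have : x + k < b by lia.
  elim: k {yE} => [|k IH] xk.
    by have := H x; rewrite addn0 /ascent_at inord_val => -> //; lia.
  have := H (x + k.+1); rewrite /ascent_at addnS => H1.
  by apply: ltn_trans (IH _) _; rewrite ?H1 //; lia.
- right; apply/forallP => x; apply/forallP => y; apply/implyP => /and3P[/= ax xy yb].
  have step i : a <= i < b -> s (inord i.+1) < s (inord i).
    move=> aib; rewrite ltn_neqAle leqNgt [_ < _]H // andbT.
    apply/negP => /eqP/val_inj/perm_inj/(congr1 val).
    by rewrite /= !inordK; lia.
  have [k yE] : exists k, y = (x + k).+1 :> nat by exists (y - x.+1); lia.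
  have -> : y = inord (x + k).+1 by rewrite -yE inord_val.
  have : x + k < b by lia.
  elim: k {yE} => [|k IH] xk.
    by have := step x; rewrite addn0 inord_val => -> //; lia.
  rewrite addnS; apply: leq_trans (IH _); last by lia.
  by apply: ltnW; apply: step; lia.
Qed.

(** A monotone segment can be prolonged past an inner end point unless the
    direction changes there. *)
Lemma is_birunP n (s : 'S_n.+2) (a b : 'I_n.+2) :
  reflect [/\ a < b, forall i, a <= i < b -> ascent_at s i = ascent_at s a,
              0 < a -> turn_at s a & (b == n.+1 :> nat) || turn_at s b]
          (is_birun s (a, b)).
Proof.
have bn := ltn_ord b; have an := ltn_ord a.
apply: (iffP and3P) => [[/= ab /monotone_segP[d Hd] /forallP max]|].
  have {}max (a' b' : nat) d' : a' <= a -> b <= b' -> b' <= n.+1 ->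
      (forall i, a' <= i < b' -> ascent_at s i = d') -> a' = a /\ b' = b.
    move=> a'a bb' b'n H.
    have := max (inord a', inord b'); rewrite /= !inordK ?a'a ?bb' /=; try lia.
    have -> : monotone_seg s (inord a', inord b').
      by apply/monotone_segP; exists d' => i; rewrite !inordK; [exact: H|lia|lia].
    by case/eqP => <- <-; rewrite !inordK; lia.
  have {}ab : a < b.
    rewrite ltnNge; apply/negP => ba; have {}ab : a = b :> nat by lia.
    have [b0|b0] := posnP b.
      have [] := max 0 1 (ascent_at s 0); rewrite ?b0 //.
      by case.
    have [] := max b.-1 b (ascent_at s b.-1); try lia.
    by move=> i ib; congr ascent_at; lia.
  have aE : ascent_at s a = d by apply: Hd; lia.
  split=> //; first by move=> i /Hd ->.
    rewrite /turn_at; case aE': (nat_of_ord a) => [//|a'] _; rewrite -aE' aE.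
    apply/eqP => a'E; have [||||] := max a' b d; try lia.
    move=> i ib; have [->//|ia'] := eqVneq i a'.
    by apply: Hd; lia.
  have [//|bn1 /=] := eqVneq.
  rewrite /turn_at; case bE: (nat_of_ord b) ab => [//|b'] ab.
  rewrite (Hd b') ?bE; last by lia.
  rewrite -bE; apply/eqP => bE'; have [||||] := max a b.+1 d; try lia.
  move=> i ib; have [->//|ib'] := eqVneq i b.
  by apply: Hd; lia.
case=> ab H Ha Hb; split; first exact: ltnW.
  by apply/monotone_segP; exists (ascent_at s a).
apply/forallP => -[a' b']; apply/implyP => /and3P[/= a'a bb' /monotone_segP[d Hd]].
have aE : ascent_at s a = d by apply: Hd; lia.
rewrite -pair_eqE /= -!val_eqE /=; apply/andP; split.
  rewrite eqn_leq a'a leqNgt; apply/negP => lt_a'.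
  have := Ha (leq_ltn_trans (leq0n _) lt_a'); rewrite /turn_at.
  case E: (nat_of_ord a) lt_a' => [//|c] lt_a'; rewrite -E aE Hd ?eqxx //; lia.
rewrite eqn_leq bb' andbT leqNgt; apply/negP => lt_b.
have b'n := ltn_ord b'.
case/orP: Hb => [/eqP ?|]; first by lia.
rewrite /turn_at; case E: (nat_of_ord b) ab => [//|c] ab.
by rewrite -E !Hd ?eqxx //; lia.
Qed.

(** Two runs that end at the same place share their last step, hence their
    direction, and maximality makes them start together. *)
Lemma updown_run_inj n (s : 'S_n.+2) (I J : 'I_n.+2 * 'I_n.+2) :
  is_updown_run s I -> is_updown_run s J -> I.2 = J.2 -> I = J.
Proof.
case: I J => a r [b r']; rewrite /is_updown_run /= => HI HJ rr'.
rewrite -{r'}rr' in HJ *.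
have birun_le (c d : 'I_n.+2) : is_birun s (c, r) -> is_birun s (d, r) -> c <= d.
  move=> /is_birunP[cr Hc Tc _] /is_birunP[dr Hd _ _].
  rewrite leqNgt; apply/negP => dc.
  have := Tc (leq_ltn_trans (leq0n _) dc); rewrite /turn_at.
  case E: (nat_of_ord c) dc => [//|e] dc.
  by rewrite -E !Hd ?eqxx //; lia.
congr (_, _); apply: val_inj => /=.
case/orP: HI => HI; case/orP: HJ => HJ.
- by apply/eqP; rewrite eqn_leq !birun_le.
- by case/is_birunP: HI => ar _ _ _; case/and3P: HJ => _ /eqP r0 _; lia.
- by case/is_birunP: HJ => ar _ _ _; case/and3P: HI => _ /eqP r0 _; lia.
- by case/and3P: HI => /eqP ->; case/and3P: HJ => /eqP ->.
Qed.

Lemma descent_atE n (s : 'S_n.+1) (i : 'I_n.+1) :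
  descent_at s i = (i < n) && ~~ ascent_at s i.
Proof.
apply/existsP/andP => [[j /andP[/eqP ji sji]]|[i_n]].
  have jn := ltn_ord j; split; first by lia.
  by rewrite /ascent_at -ji !inord_val -leqNgt ltnW.
rewrite /ascent_at -leqNgt leq_eqVlt => /orP[/eqP/val_inj/perm_inj/(congr1 val)|lt_s].
  by rewrite /= !inordK; lia.
by exists (inord i.+1); move: lt_s; rewrite inord_val inordK ?eqxx ?ltnS.
Qed.

(** The up-down runs end at the turns and at the last position. The run made of
    the first letter alone accounts for a turn at 0. *)
Lemma updown_run_ends n (s : 'S_n.+2) :
  [set I.2 | I in [set I | is_updown_run s I]] =
  [set r : 'I_n.+2 | (r == n.+1 :> nat) || turn_at s r].
Proof.
apply/setP => r; rewrite inE; apply/imsetP/idP => [[[a b]]|].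
  rewrite inE => + ->; case/orP => [/is_birunP[] //|/and3P[/= /eqP a0 /eqP ->]].
  by rewrite descent_atE a0 /turn_at => /andP[_ /negPf ->]; rewrite orbT.
have rn := ltn_ord r.
have [r0|r_gt0] := posnP r.
  rewrite r0 /= /turn_at => H; exists (ord0, r) => //; rewrite inE /is_updown_run /=.
  by rewrite r0 descent_atE /=; move: H; case: ascent_at; rewrite ?orbT.
move=> Tr.
have ex : exists a, (a < r) && all (fun i => ascent_at s i == ascent_at s r.-1) (iota a (r - a)).
  exists r.-1; rewrite prednK // leqnn /=.
  have -> : r - r.-1 = 1 by lia.
  by rewrite /= eqxx.
case: (ex_minnP ex) => a /andP[ar /allP Ha] amin.
have {}Ha i : a <= i < r -> ascent_at s i = ascent_at s r.-1.
  move=> ir; apply: (eqP (Ha i _)); rewrite mem_iota; lia.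
exists (inord a, r) => //; rewrite inE /is_updown_run.
have an : a < n.+2 by lia.
apply/orP; left; apply/is_birunP; rewrite inordK //; split=> //.
  by move=> i ir; rewrite !Ha //; lia.
case: a ar Ha amin an => [//|a] ar Ha amin an _; rewrite /turn_at.
apply/eqP => Ea; suff /amin : (a < r) &&
    all (fun i => ascent_at s i == ascent_at s r.-1) (iota a (r - a)) by rewrite ltnn.
apply/andP; split; first by lia.
apply/allP => i; rewrite mem_iota => ir; have [->|ia] := eqVneq i a.
  by rewrite -Ea Ha //; lia.
by rewrite Ha //; lia.
Qed.

Lemma changes_ascents n (s : 'S_n.+1) :
  changes (rev (ascents s)) = \sum_(i < n) turn_at s i.
Proof.
have mkseqS k : rev (mkseq (ascent_at s) k.+1) =
    ascent_at s k :: rev (mkseq (ascent_at s) k).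
  by rewrite /mkseq -addn1 iotaD map_cat rev_cat.
suff H k : changes (rev (mkseq (ascent_at s) k)) = \sum_(i < k) turn_at s i.
  exact: H.
elim: k => [|k IH]; first by rewrite big_ord0.
rewrite mkseqS big_ord_recr /= IH addnC; congr (_ + _).
by rewrite /turn_at; case: k {IH} => [|k] //; rewrite mkseqS.
Qed.

Lemma udr_changes n (s : 'S_n.+2) : udr s = (changes (rev (ascents s))).+1.
Proof.
rewrite /udr -(card_in_imset (f := snd)); last first.
  by move=> I J; rewrite !inE; exact: updown_run_inj.
rewrite updown_run_ends -sum1dep_card big_mkcond big_ord_recr /= eqxx addn1.
rewrite changes_ascents; congr _.+1; apply: eq_bigr => i _.
by rewrite ltn_eqF //=; case: turn_at.
Qed.

Lemma des_count n (s : 'S_n.+1) : des s = count negb (rev (ascents s)).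
Proof.
rewrite /des count_rev count_map -sum1dep_card big_mkcond big_ord_recr /=.
rewrite descent_atE ltnn addn0 -sum1_count.
rewrite -[n in iota 0 n]subn0 -/(index_iota 0 n) big_mkord [RHS]big_mkcond.
by apply: eq_bigr => i _; rewrite descent_atE /= ltn_ord.
Qed.

(** * Permutations as orders, and the count of all words *)

Lemma card_ord_lt n m : m <= n -> #|[set k : 'I_n | k < m]| = m.
Proof.
move=> mn; rewrite -sum1dep_card -(big_ord_widen n (fun=> 1) mn).
by rewrite sum1_card card_ord.
Qed.

Lemma perm_order_inj n (f g : 'S_n) :
  (forall i j, (f i < f j) = (g i < g j)) -> f = g.
Proof.
have rankE (h : 'S_n) i : #|[set j | h j < h i]| = h i.
  rewrite -[RHS](card_ord_lt (ltnW (ltn_ord (h i)))).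
  rewrite -[RHS](card_preimset _ (@perm_inj _ h)).
  by apply: eq_card => j; rewrite !inE.
move=> fg; apply/permP => i; apply: val_inj; rewrite /= -[LHS]rankE -[RHS]rankE.
by apply: eq_card => j; rewrite !inE fg.
Qed.

(** Ranking the values of an injective key turns any total order into a
    permutation; orders on a finite set are represented in this way below. *)
Lemma rank_perm n (K : 'I_n -> nat) :
  injective K -> exists f : 'S_n, forall i j, (f i < f j) = (K i < K j).
Proof.
move=> K_inj; pose below i := [set j | K j < K i].
have lt_below i j : K i < K j -> #|below i| < #|below j|.
  move=> ij; apply/proper_card/properP; split.
    by apply/subsetP => k; rewrite !inE => /ltn_trans; apply.
  by exists i; rewrite !inE ?ltnn.
have rank_lt i : #|below i| < n.
  rewrite -[X in _ < X]card_ord -cardsT; apply/proper_card/properP.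
  by split; [apply/subsetP | exists i; rewrite !inE ?ltnn].
have rankE i j : (#|below i| < #|below j|) = (K i < K j).
  apply/idP/idP; last exact: lt_below.
  case: (ltngtP (K i) (K j)) => [//|/lt_below|/K_inj -> //]; last by rewrite ltnn.
  by case: ltngtP.
have rank_inj : injective (fun i => Ordinal (rank_lt i)).
  move=> i j /(congr1 val) /= eq_ij; apply: K_inj.
  by have := rankE i j; have := rankE j i; rewrite eq_ij ltnn; case: ltngtP.
by exists (perm rank_inj) => i j; rewrite !permE /= rankE.
Qed.

Lemma exchange_card (S W : finType) (Q : S -> W -> bool) :
  \sum_s #|[set w | Q s w]| = \sum_w #|[set s | Q s w]|.
Proof.
under eq_bigr => s _ do rewrite -sum1dep_card big_mkcond.
by rewrite exchange_big; apply: eq_bigr => w _; rewrite -big_mkcond sum1dep_card.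
Qed.

Lemma card_fits_perm neg n m (s g : 'S_n) :
  #|[set f : {ffun 'I_n -> 'I_m} | fits neg s f]| =
  #|[set w : {ffun 'I_n -> 'I_m} | fits neg s [ffun i => w (g i)]]|.
Proof.
pose h (w : {ffun 'I_n -> 'I_m}) := [ffun i => w (g i)].
have h_inj : injective h.
  move=> w w' /ffunP eq_w; apply/ffunP => i.
  by have := eq_w (g^-1%g i); rewrite !ffunE permKV.
by rewrite -[LHS](card_preimset _ h_inj); apply: eq_card => w; rewrite !inE.
Qed.

(** The map (s, f) to f o s^-1 is a bijection onto all words: its inverse is the
    standardization, which sorts the positions of a word by letter and then from
    left to right. *)
Lemma sum_card_fits_pos n m :
  \sum_(s : 'S_n) #|[set f : {ffun 'I_n -> 'I_m} | fits pred0 s f]| = m ^ n.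
Proof.
rewrite (eq_bigr _ (fun s _ => card_fits_perm pred0 m s s)).
have -> : m ^ n = #|{ffun 'I_n -> 'I_m}| by rewrite card_ffun !card_ord.
rewrite exchange_card -sum1_card; apply: eq_bigr => w _.
(* Comparing keys is comparing letters first and positions next. *)
pose K (a : 'I_n) := w a * n + a.
have K_lt a b : (K a < K b) = (w a < w b) || (w a == w b) && (a < b).
  have := ltn_ord a; have := ltn_ord b; rewrite /K -val_eqE /=.
  case: (ltngtP (w a) (w b)) => [lt_w|lt_w|->] an bn; last by rewrite ltn_add2l.
    have : (w a).+1 * n <= w b * n by rewrite leq_mul.
    by rewrite mulSn /=; move: (w a * n) (w b * n) => x y; lia.
  have : (w b).+1 * n <= w a * n by rewrite leq_mul.
  by rewrite mulSn /=; move: (w a * n) (w b * n) => x y; lia.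
have K_inj : injective K.
  move=> a b Kab; apply: val_inj => /=.
  have := K_lt a b; have := K_lt b a; rewrite Kab ltnn [w b == _]eq_sym -val_eqE /=.
  by case: (ltngtP (w a) (w b)); case: (ltngtP a b).
have [g gE] := rank_perm K_inj.
rewrite -[RHS](cards1 (g^-1)%g); apply: eq_card => s; rewrite !inE.
have fitsE : fits pred0 s [ffun i => w (s i)] =
   [forall i : 'I_n, forall j : 'I_n, (i < j) ==> (K (s i) < K (s j))].
  apply: eq_forallb => i; apply: eq_forallb => j; congr (_ ==> _).
  by rewrite /tlex /= !ffunE K_lt addbF -val_eqE.
rewrite fitsE; apply/forallP/eqP => [H|-> i].
  rewrite -[s]invgK; congr (_^-1)%g; apply: perm_order_inj => i j; rewrite gE.
  have {}H (a b : 'I_n) : a < b -> K (s a) < K (s b) by have /forallP/(_ b)/implyP := H a.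
  have := H ((s^-1)%g i) ((s^-1)%g j); have := H ((s^-1)%g j) ((s^-1)%g i).
  rewrite !permKV; case: (ltngtP (s^-1 i)%g (s^-1 j)%g) => //.
  - by move=> _ _ /(_ isT) ->.
  - by move=> _ /(_ isT); case: ltngtP.
  by move=> /val_inj/perm_inj -> _ _; rewrite ltnn.
by apply/forallP => j; apply/implyP; rewrite -gE !permKV.
Qed.

(** * Cyclic permutations as conjugates of the shift *)

(** The standard n-cycle, sending each place of a circular word to the next. *)
Definition shift n : 'S_n := perm (@ordS_inj n).

(** The order on places given by [f] compares two places as their letters do
    and, for equal letters, as the following places do, up to the sign of the
    letter. *)
Definition consistent neg n m (w : {ffun 'I_n -> 'I_m}) (f : 'S_n) : bool :=
  [forall k : 'I_n, forall l : 'I_n, (f k < f l) ==>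
    tlex neg (val (w k), val (f (ordS k))) (val (w l), val (f (ordS l)))].

(** Transport along [f] identifies words fitting the cyclic permutation with
    circular words consistent with [f]. *)
Lemma fits_shift_conj neg n m (w : {ffun 'I_n -> 'I_m}) (f : 'S_n) :
  fits neg (shift n ^ f)%g [ffun i => w (f^-1%g i)] = consistent neg w f.
Proof.
have permE' k : (shift n ^ f)%g (f k) = f (ordS k) by rewrite permJ permE.
apply/forallP/forallP => H k; apply/forallP => l.
  by have /forallP/(_ (f l)) := H (f k); rewrite !ffunE !permE' !permK.
have /forallP/(_ (f^-1%g l)) := H (f^-1%g k).
by rewrite !ffunE !permKV -!permE' !permKV.
Qed.

Lemma shift_expE n (k : nat) (i : 'I_n) : (shift n ^+ k)%g i = (i + k) %% n :> nat.
Proof.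
elim: k => [|k IH]; first by rewrite expg0 perm1 addn0 modn_small.
by rewrite expgSr permM permE /= IH -addn1 modnDml addn1 addnS.
Qed.

Lemma shift_exp_onto n (i j : 'I_n) : exists k, (shift n ^+ k)%g i = j.
Proof.
exists (n - i + j); apply: val_inj; rewrite /= shift_expE.
by rewrite addnA subnKC ?modnDl ?modn_small // ltnW.
Qed.

Lemma cyclic_permP n (s : 'S_n.+1) :
  reflect (forall i, porbit s i = setT) (cyclic_perm s).
Proof.
apply: (iffP eqP) => [H i|H].
  by apply/set1P; rewrite -H; apply: imset_f.
apply/setP => A; rewrite inE; apply/imsetP/eqP => [[i _ ->]//|->].
by exists ord0.
Qed.

Lemma cyclic_shift_conj n (f : 'S_n.+1) : cyclic_perm (shift n.+1 ^ f)%g.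
Proof.
apply/cyclic_permP => i; apply/setP => j; rewrite inE.
have [k kE] := shift_exp_onto (f^-1%g i) (f^-1%g j).
have <- : ((shift n.+1 ^ f) ^+ k)%g i = j.
  by rewrite -[i](permKV f) -conjXg permJ kE permKV.
by rewrite mem_porbit.
Qed.

(** A transport of the shift to [s] is determined by where it sends place 0, and
    any image is possible. *)
Lemma card_shift_conj n (s : 'S_n.+1) : cyclic_perm s ->
  #|[set f : 'S_n.+1 | (shift n.+1 ^ f)%g == s]| = n.+1.
Proof.
move=> /cyclic_permP s_cyc.
rewrite -[RHS]card_ord -cardsT -(card_in_imset (f := fun f : 'S_n.+1 => f ord0)).
  apply: eq_card => x; rewrite inE; apply/imsetP.
  have porb : #|porbit s x| = n.+1 by rewrite s_cyc cardsT card_ord.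
  have f_inj : injective (fun k : 'I_n.+1 => iter k s x).
    move=> k l; rewrite -!(nth_traject s (n := n.+1)) // => /eqP.
    have U : uniq (traject s x n.+1) by have := uniq_traject_porbit s x; rewrite porb.
    by rewrite nth_uniq ?size_traject // => /eqP /val_inj.
  exists (perm f_inj); last by rewrite permE.
  rewrite inE; apply/eqP/permP => y; rewrite -[y](permKV (perm f_inj)).
  rewrite permJ; move: ((perm f_inj)^-1%g y) => k; rewrite !permE /=.
  rewrite -iterS; have := ltn_ord k; rewrite ltnS leq_eqVlt => /orP[/eqP ->|kn].
    by rewrite modnn /=; have := iter_porbit s x; rewrite porb.
  by rewrite modn_small.
move=> f g; rewrite !inE => /eqP fs /eqP gs fg; apply/permP => i.
have [k <-] := shift_exp_onto ord0 i.
by rewrite -[LHS]permJ -[RHS]permJ !conjXg fs gs fg.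
Qed.

Lemma sum_cyclic_fits neg n m :
  n.+1 * \sum_(s : 'S_n.+1 | cyclic_perm s)
     #|[set f : {ffun 'I_n.+1 -> 'I_m} | fits neg s f]|
  = \sum_(w : {ffun 'I_n.+1 -> 'I_m}) #|[set f | consistent neg w f]|.
Proof.
rewrite -exchange_card.
rewrite [RHS](partition_big (fun f => shift n.+1 ^ f)%g (@cyclic_perm n.+1)) /=; last first.
  by move=> f _; exact: cyclic_shift_conj.
rewrite big_distrr; apply: eq_bigr => s s_cyc /=.
rewrite (eq_bigr (fun=> #|[set f : {ffun 'I_n.+1 -> 'I_m} | fits neg s f]|)).
  rewrite sum_nat_cond_const; congr (_ * _); rewrite -[LHS](card_shift_conj s_cyc).
  by apply: eq_card => f; rewrite !inE.
move=> f /eqP <-; rewrite (card_fits_perm _ _ _ f^-1%g).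
by apply: eq_card => w; rewrite !inE fits_shift_conj.
Qed.

(** * Orders consistent with a circular word *)

Section Words.

Variables (m n : nat).
Implicit Types (w : {ffun 'I_n.+1 -> 'I_m}).

(** The periodic reading of a circular word. *)
Definition letter w (k : nat) : nat := w (inZp k).

Lemma letter_mod w k : letter w (k %% n.+1) = letter w k.
Proof. by congr (val (w _)); apply: val_inj; rewrite /= modn_mod. Qed.

Lemma letter_ord w (i : 'I_n.+1) : letter w i = w i.
Proof. by rewrite /letter valZpK. Qed.

Definition period w (q : nat) : bool :=
  [forall i : 'I_n.+1, letter w (i + q) == letter w i].

Lemma periodP w q : reflect (forall k, letter w (k + q) = letter w k) (period w q).
Proof.
apply: (iffP forallP) => [H k|H i]; last by rewrite H.
by have /eqP := H (inZp k); rewrite /= -letter_mod modnDml !letter_mod.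
Qed.

Lemma period_size w : period w n.+1.
Proof. by apply/periodP => k; rewrite -letter_mod modnDr letter_mod. Qed.

Lemma has_period w : exists q, (0 < q) && period w q.
Proof. by exists n.+1; rewrite period_size. Qed.

Definition minper w : nat := ex_minn (has_period w).

Lemma minper_gt0 w : 0 < minper w.
Proof. by rewrite /minper; case: ex_minnP => q /andP[]. Qed.

(** The periods are the multiples of the least one. In particular the minimal
    period divides the length, and words of different lengths with the same
    periodic reading have the same minimal period. *)
Lemma period_dvd w q : period w q = (minper w %| q).
Proof.
rewrite /minper; case: ex_minnP => p /andP[p_gt0 /periodP wp] pmin.
have wpM k j : letter w (k + j * p) = letter w k.
  by elim: j => [|j IH]; rewrite ?mul0n ?addn0 // mulSnr addnA wp.
apply/periodP/dvdnP => [wq|[j ->]] //.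
exists (q %/ p); rewrite {1}(divn_eq q p).
have [->|r_gt0] := posnP (q %% p); first by rewrite addn0.
suff /pmin : (0 < q %% p) && period w (q %% p) by rewrite leqNgt ltn_mod p_gt0.
rewrite r_gt0; apply/periodP => k.
by rewrite -(wpM _ (q %/ p)) -addnA [_ %% _ + _]addnC -divn_eq.
Qed.

Lemma minper_dvd w : minper w %| n.+1.
Proof. by rewrite -period_dvd period_size. Qed.

Lemma iter_ordS k (i : 'I_n.+1) : iter k (@ordS n.+1) i = inZp (i + k).
Proof.
apply: val_inj; elim: k => [|k IH] /=; first by rewrite addn0 modn_small.
by rewrite IH /= -addn1 modnDml addn1 addnS.
Qed.

Lemma agree_minper w (k l : 'I_n.+1) :
  (forall i, i < n.+1 -> w (iter i (@ordS _) k) = w (iter i (@ordS _) l)) ->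
  k = l %[mod minper w].
Proof.
move=> H.
have {}H i : letter w (k + i) = letter w (l + i).
  have := H (i %% n.+1) (ltn_pmod i (ltn0Sn n)); rewrite !iter_ordS => /(congr1 val).
  rewrite -!/(letter _ _) -[LHS]letter_mod -[RHS]letter_mod !modnDmr !letter_mod.
  by [].
have kn := ltn_ord k.
have : period w (l + (n.+1 - k)).
  apply/periodP => x; rewrite addnCA -H addnCA [k + _]addnC subnK 1?ltnW //.
  by have /periodP -> := period_size w.
rewrite period_dvd => /eqP pk; apply/eqP.
rewrite -(eqn_modDr (n.+1 - k)) pk [k + _]addnC subnK 1?ltnW //.
by have := minper_dvd w; rewrite /dvdn eq_sym => /eqP ->.
Qed.

End Words.

Section ConsistentOrders.

Variables (neg : pred nat) (m n : nat) (w : {ffun 'I_n.+1 -> 'I_m}).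
Implicit Types (f g : 'S_n.+1) (k l : 'I_n.+1).

Local Notation S := (@ordS n.+1).

Local Notation lex f k l :=
  (tlex neg (val (w k), val (f (S k))) (val (w l), val (f (S l)))).

(** An order [f] on places induces another one, comparing first by letters and
    then by [f] on the successors. The consistent orders are the fixed points of
    this map. *)
Lemma pull_back : exists P : 'S_n.+1 -> 'S_n.+1,
  forall f k l, k != l -> (P f k < P f l) = lex f k l.
Proof.
suff step f : exists g : 'S_n.+1, forall k l, k != l -> (g k < g l) = lex f k l.
  by have [P P_lt] := fin_all_exists step; exists P.
(* A key in base n + 1 whose second digit is complemented below a negative
   letter. *)
pose K k := w k * n.+1 + (if neg (w k) then n - f (S k) else f (S k)).
have K_lt k l : k != l -> (K k < K l) = lex f k l.
  move=> kl.
  have : f (S k) != f (S l) by rewrite (inj_eq perm_inj) (inj_eq (@ordS_inj _)).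
  have := ltn_ord (f (S k)); have := ltn_ord (f (S l)).
  rewrite /K /tlex -val_eqE /=.
  case: (ltngtP (w k) (w l)) => [lt_w|lt_w|->] fl fk fkl /=; last first.
  - by rewrite ltn_add2l; case: (neg _) => /=; lia.
  - have : (w l).+1 * n.+1 <= w k * n.+1 by rewrite leq_mul.
    rewrite mulSn /=; move: (w k * n.+1) (w l * n.+1) => x y.
    by case: (neg _); case: (neg _); lia.
  - have : (w k).+1 * n.+1 <= w l * n.+1 by rewrite leq_mul.
    rewrite mulSn /=; move: (w k * n.+1) (w l * n.+1) => x y.
    by case: (neg _); case: (neg _); lia.
have K_inj : injective K.
  move=> k l Kkl; apply/eqP; apply: contraT => kl.
  have := K_lt _ _ kl; have := K_lt l k; rewrite eq_sym Kkl ltnn => /(_ kl).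
  have : f (S k) != f (S l) by rewrite (inj_eq perm_inj) (inj_eq (@ordS_inj _)).
  rewrite /tlex -val_eqE /=; case: (ltngtP (w k) (w l)) => //= ->.
  by case: ltngtP; case: (neg _).
have [g gE] := rank_perm K_inj.
by exists g => k l kl; rewrite gE K_lt.
Qed.

Lemma consistentP f :
  reflect (forall k l, k != l -> (f k < f l) = lex f k l) (consistent neg w f).
Proof.
apply: (iffP forallP) => [H k l kl|H k].
  have {}H a b : f a < f b -> lex f a b by have /forallP/(_ b)/implyP := H a.
  apply/idP/idP; first exact: H.
  have fkl : f k != f l by rewrite (inj_eq perm_inj).
  have := H l k; rewrite -val_eqE /= in fkl.
  have : f (S k) != f (S l) by rewrite (inj_eq perm_inj) (inj_eq (@ordS_inj _)).
  rewrite /tlex -val_eqE /=; case: (ltngtP (f k) (f l)) fkl => //= _ _.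
  move=> fS /(_ isT); case: (ltngtP (w k) (w l)) => //= ->.
  by move: fS; case: ltngtP; case: (neg _).
apply/forallP => l; apply/implyP => kl; rewrite -H //.
by apply: contraTneq kl => ->; rewrite ltnn.
Qed.

Section Iterates.

Variable P : 'S_n.+1 -> 'S_n.+1.
Hypothesis P_lt : forall f k l, k != l -> (P f k < P f l) = lex f k l.

Lemma fixed_consistent f : consistent neg w f = (P f == f).
Proof.
apply/consistentP/eqP => [H|Pf k l kl]; last by rewrite -{1 2}Pf P_lt.
apply: perm_order_inj => k l; have [->|kl] := eqVneq k l; first by rewrite !ltnn.
by rewrite P_lt // H.
Qed.

(** After j pull-backs, two places compare according to the first difference
    among the j letters that follow them; only when there is none does the
    initial order matter. *)
Lemma iter_pull_back j f g k l : k != l ->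
  ((forall i, i < j -> w (iter i S k) = w (iter i S l)) ->
     (f (iter j S k) < f (iter j S l)) = (g (iter j S k) < g (iter j S l))) ->
  (iter j P f k < iter j P f l) = (iter j P g k < iter j P g l).
Proof.
elim: j k l => [|j IH] k l kl H; first by apply: H.
rewrite !iterS !P_lt // /tlex /=.
have [wkl|//] := eqVneq (w k : nat) (w l).
rewrite wkl ltnn /=; congr (_ (+) _); apply: IH.
  by rewrite (inj_eq (@ordS_inj _)).
move=> H'; rewrite -!iterSr; apply: H => -[_|i ij]; first exact: val_inj.
by rewrite !iterSr; apply: H'.
Qed.

(** Two places whose next n letters agree have equal periodic readings, so they
    are congruent modulo the minimal period. *)
Lemma eq_iter_pull_back f g :
  (forall k l, k != l -> k = l %[mod minper w] -> (f k < f l) = (g k < g l)) ->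
  iter n.+1 P f = iter n.+1 P g.
Proof.
move=> H; apply: perm_order_inj => k l.
have [->|kl] := eqVneq k l; first by rewrite !ltnn.
apply: iter_pull_back => // /agree_minper kl'.
have iterE (i : 'I_n.+1) : iter n.+1 S i = i.
  by apply: val_inj; rewrite iter_ordS /= modnDr modn_small.
by rewrite !iterE; apply: H.
Qed.

Lemma fixed_iter f j : P f = f -> iter j P f = f.
Proof. by move=> Pf; elim: j => //= j ->. Qed.

End Iterates.

(** All places have different readings, so the n-th iterate of the pull-back is a
    constant map; its value is the only fixed point. *)
Lemma card_consistent_primitive :
  minper w = n.+1 -> #|[set f | consistent neg w f]| = 1.
Proof.
move=> wp; have [P P_lt] := pull_back.
have iterP f g : iter n.+1 P f = iter n.+1 P g.
  apply: eq_iter_pull_back => // k l /eqP kl; rewrite wp !modn_small //.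
  by move/val_inj.
rewrite -[RHS](cards1 (iter n.+1 P 1%g)); apply: eq_card => f; rewrite !inE.
rewrite (fixed_consistent P_lt); apply/eqP/eqP => [Pf|->].
  by rewrite (iterP _ f) fixed_iter.
by rewrite -iterS iterSr; apply: iterP.
Qed.

Definition neg_letters (q : nat) : nat := \sum_(i < q) neg (letter w i).

Lemma neg_lettersS q : neg_letters q.+1 = neg_letters q + neg (letter w q).
Proof. exact: big_ord_recr. Qed.

Lemma neg_lettersD p q : period w p -> neg_letters (p + q) = neg_letters p + neg_letters q.
Proof.
move=> /periodP wp; elim: q => [|q IH]; first by rewrite addn0 /neg_letters big_ord0 addn0.
by rewrite addnS !neg_lettersS IH addnA [p + q]addnC wp.
Qed.

(** Two places at distance a period carry the same letter, so their comparison
    is that of their successors, up to the sign of this letter. *)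
Lemma consistent_period_step f k q : consistent neg w f -> period w q ->
  ~~ (n.+1 %| q) ->
  (f k < f (iter q S k)) = (f (S k) < f (iter q S (S k))) (+) neg (w k).
Proof.
move=> /consistentP f_lt /periodP wq nq.
rewrite f_lt.
  rewrite /tlex /= iter_ordS -/(letter w (k + q)) wq letter_ord ltnn eqxx /=.
  by congr (_ (+) _); rewrite -iter_ordS -iterS iterSr.
apply: contra nq => /eqP/(congr1 val); rewrite iter_ordS /= => kE.
rewrite /dvdn -[X in _ == X](mod0n n.+1) -(eqn_modDl k) addn0 -kE.
by rewrite modn_small.
Qed.

Lemma consistent_period_iter f k q j : consistent neg w f -> period w q ->
  ~~ (n.+1 %| q) ->
  (f ord0 < f (iter q S ord0)) =
  (f (iter j S ord0) < f (iter q S (iter j S ord0))) (+) odd (neg_letters j).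
Proof.
move=> fc wq nq; elim: j => [|j ->]; first by rewrite /neg_letters big_ord0 addbF.
rewrite (consistent_period_step _ fc wq nq) /= neg_lettersS oddD oddb -addbA.
by rewrite {3}iter_ordS [_ (+) odd _]addbC.
Qed.

(** If a period [q] had an even number of negative letters, all comparisons of a
    place with the one [q] further would agree along the orbit of 0 under
    translation by [q], which would then be monotone although it closes up. *)
Lemma odd_neg_letters_period f q : consistent neg w f -> period w q ->
  ~~ (n.+1 %| q) -> odd (neg_letters q).
Proof.
move=> fc wq nq; apply: contraT => even_q.
pose u i := iter (i * q) S ord0 : 'I_n.+1.
have uS i : u i.+1 = iter q S (u i) by rewrite /u mulSn iterD.
have even_mul i : ~~ odd (neg_letters (i * q)).
  elim: i => [|i IH]; first by rewrite /neg_letters big_ord0.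
  by rewrite mulSn neg_lettersD // oddD negb_add (negPf IH) (negPf even_q).
have un : u n.+1 = u 0.
  by apply: val_inj; rewrite /u !iter_ordS /= add0n modnMr.
have uE i : (f (u i) < f (u i.+1)) = (f (u 0) < f (u 1)).
  rewrite [u 1]uS uS [RHS](consistent_period_iter ord0 (i * q) fc wq nq).
  by rewrite (negPf (even_mul i)) addbF.
have u_neq i : f (u i) != f (u i.+1) :> nat.
  apply/negP => /eqP/val_inj/perm_inj/(congr1 val).
  rewrite uS iter_ordS /= => kE; case/negP: nq.
  rewrite /dvdn -[X in _ == X](mod0n n.+1) -(eqn_modDl (u i)) addn0 -kE.
  by rewrite modn_small.
case: (boolP (f (u 0) < f (u 1))) => [up|down].
  have mono i : f (u 0) + i <= f (u i).
    elim: i => [|i IH]; first by rewrite addn0.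
    by rewrite addnS (leq_ltn_trans IH) // uE.
  by have := mono n.+1; rewrite un addnS ltnNge leq_addr.
have mono i : f (u i) + i <= f (u 0).
  elim: i => [|i IH]; first by rewrite addn0.
  apply: leq_trans IH; rewrite addnS -addSn leq_add2r.
  by rewrite ltn_neqAle eq_sym u_neq leqNgt uE.
by have := mono n.+1; rewrite un addnS ltnNge leq_addr.
Qed.

(** The minimal period has an odd number of negative letters by
    [odd_neg_letters_period], so its double has an even number of them, and the
    same lemma makes the double a multiple of the length. *)
Lemma card_consistent_none :
  minper w != n.+1 -> ~~ ((minper w).*2 == n.+1) || ~~ odd (neg_letters (minper w)) ->
  #|[set f | consistent neg w f]| = 0.
Proof.
set p := minper w => pn H; apply/eqP; rewrite cards_eq0 -subset0.
apply/subsetP => f; rewrite inE => fc.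
have wp : period w p by rewrite period_dvd.
have pdvd : p %| n.+1 := minper_dvd w.
have np : ~~ (n.+1 %| p).
  by apply: contra pn => np; rewrite eqn_dvd np pdvd.
have odd_p := odd_neg_letters_period fc wp np.
have w2p : period w (p + p) by rewrite period_dvd dvdn_addr.
have [n2p|n2p] := boolP (n.+1 %| p + p); last first.
  by have := odd_neg_letters_period fc w2p n2p; rewrite neg_lettersD // oddD odd_p.
move: H; rewrite odd_p orbF => /negP[].
have [[|[|j]] nE] := dvdnP pdvd; first by [].
  by rewrite nE mul1n eqxx in pn.
have := dvdn_leq _ n2p; rewrite addn_gt0 minper_gt0 => /(_ isT).
rewrite nE -addnn !mulSn eqn_leq leq_add2l => ->.
by rewrite leq_add2l leq_addr.
Qed.

(** The readings only fail to separate opposite places. A consistent order is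
    determined by its comparisons of opposite places, and these by the comparison
    of 0 with its opposite, each step around the circle reversing them at a
    negative letter. Both initial choices occur: going half way around reverses
    the comparison, as required between a pair of places and the swapped pair. *)
Lemma card_consistent_double :
  (minper w).*2 = n.+1 -> odd (neg_letters (minper w)) ->
  #|[set f | consistent neg w f]| = 2.
Proof.
set p := minper w => n2p odd_p; have [P P_lt] := pull_back.
have wp : period w p by rewrite period_dvd.
have np : ~~ (n.+1 %| p).
  apply/negP => /dvdn_leq; rewrite minper_gt0 => /(_ isT).
  by rewrite -n2p -addnn -{3}[p]addn0 leq_add2l leqNgt minper_gt0.
pose opp k := iter p S k.
have opp_neq k : k != opp k.
  apply/negP => /eqP /(congr1 val); rewrite /opp iter_ordS /= => kE; case/negP: np.
  rewrite /dvdn -[X in _ == X](mod0n n.+1) -(eqn_modDl k) addn0 -kE.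
  by rewrite modn_small.
have oppE k l : k != l -> k = l %[mod p] -> l = opp k.
  move=> kl kl'; apply: val_inj; rewrite /opp iter_ordS /=.
  have := ltn_ord k; have := ltn_ord l; move: kl kl'; rewrite -val_eqE /=.
  move: (nat_of_ord k) (nat_of_ord l); rewrite -n2p => a b ab ab' bn an; move: ab.
  have : a %/ p < 2 by rewrite ltn_divLR ?minper_gt0 // mul2n.
  have : b %/ p < 2 by rewrite ltn_divLR ?minper_gt0 // mul2n.
  have rp : b %% p < p by rewrite ltn_mod minper_gt0.
  have := divn_eq b p; have := divn_eq a p; rewrite ab'; move: (b %% p) rp => r rp.
  case: (b %/ p) => [|[|//]]; case: (a %/ p) => [|[|//]] aE bE _ _ ab; try lia.
    by rewrite (_ : a + p = b + p.*2) ?modnDr ?modn_small //; lia.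
  by rewrite modn_small; lia.
have patternP f g : (forall k, (f k < f (opp k)) = (g k < g (opp k))) ->
    iter n.+1 P f = iter n.+1 P g.
  move=> H; apply: eq_iter_pull_back => // k l kl kl'.
  by rewrite (oppE k l).
have P_opp f k : (P f k < P f (opp k)) = (f (S k) < f (opp (S k))) (+) neg (w k).
  have w_opp : w (opp k) = w k :> nat.
    by rewrite /opp iter_ordS -/(letter w (k + p)) (periodP _ _ wp) letter_ord.
  rewrite P_lt // /tlex /= w_opp ltnn eqxx /=.
  by rewrite (_ : S (opp k) = opp (S k)) // /opp -iterS iterSr.
(* The comparison of place [i] with its opposite when the one at 0 is [c]. *)
pose b c i := c (+) odd (neg_letters i).
have bp c i : b c (i + p) = ~~ b c i.
  by rewrite /b addnC neg_lettersD // oddD odd_p addTb addbN.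
have bN c i : b c (i + n.+1) = b c i.
  have -> : i + n.+1 = i + p + p by lia.
  by rewrite !bp negbK.
have bn c i : b c (i %% n.+1) = b c i.
  rewrite {2}(divn_eq i n.+1); elim: (i %/ n.+1) => [|j IH]; first by rewrite mul0n.
  by rewrite mulSn -addnA addnC bN.
have bS c (k : 'I_n.+1) : b c k = b c (S k) (+) neg (w k).
  by rewrite /= bn /b neg_lettersS oddD oddb letter_ord -!addbA addbb addbF.
have b_opp c k : b c (opp k) = ~~ b c k by rewrite /opp iter_ordS /= bn bp.
have exists_fixed c : exists f, P f = f /\ (f ord0 < f (opp ord0)) = c.
  (* The places where [b] holds come first: any order comparing opposite places
     as prescribed by [b] would do. *)
  pose K (k : 'I_n.+1) := ~~ b c k * n.+1 + k.
  have K_inj : injective K.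
    move=> k l /(congr1 (modn^~ n.+1)).
    by rewrite !modnMDl !modn_small //; apply: val_inj.
  have [f0 f0E] := rank_perm K_inj.
  have f0b k : (f0 k < f0 (opp k)) = b c k.
    rewrite f0E /K b_opp; have := ltn_ord k; have := ltn_ord (opp k).
    by case: (b c k) => /=; lia.
  have iter_b j k : (iter j P f0 k < iter j P f0 (opp k)) = b c k.
    by elim: j k => [|j IH] k; rewrite ?f0b // iterS P_opp IH -bS.
  exists (iter n.+1 P f0); split.
    rewrite -iterS iterSr; apply: patternP => k.
    by rewrite -[P f0]/(iter 1 P f0) iter_b f0b.
  by rewrite iter_b /b /neg_letters big_ord0 addbF.
rewrite -[RHS]card_bool -cardsT.
rewrite -(card_in_imset (f := fun f : 'S_n.+1 => f ord0 < f (opp ord0))).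
  apply: eq_card => c; rewrite inE; apply/imsetP.
  have [f [Pf fc]] := exists_fixed c.
  by exists f; rewrite // inE (fixed_consistent P_lt) Pf.
move=> f g; rewrite !inE !(fixed_consistent P_lt) => /eqP Pf /eqP Pg fg.
rewrite -[f](fixed_iter n.+1 Pf) -[g](fixed_iter n.+1 Pg).
apply: patternP => k.
have -> : k = iter k S ord0 by rewrite iter_ordS add0n valZpK.
elim: (nat_of_ord k) => [|i IH] //=.
have := P_opp f (iter i S ord0); have := P_opp g (iter i S ord0).
by rewrite Pf Pg IH => -> /addIb.
Qed.

Lemma card_consistent :
  #|[set f | consistent neg w f]| =
  (minper w == n.+1) + (((minper w).*2 == n.+1) && odd (neg_letters (minper w))).*2.
Proof.
have [wp|wp] := eqVneq (minper w) n.+1.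
  rewrite card_consistent_primitive // wp.
  by have -> : (n.+1.*2 == n.+1) = false by lia.
case: (boolP (_ && _)) => [/andP[/eqP w2p odd_w]|]; first exact: card_consistent_double.
by rewrite negb_and => H; rewrite card_consistent_none.
Qed.

End ConsistentOrders.

(** * Counting words by minimal period *)

(** The length is written [p.-1.+1] because words are indexed by a nonempty
    ordinal type; it is [p] whenever [p] is positive. *)
Definition primitive_words m p : nat :=
  #|[set u : {ffun 'I_p.-1.+1 -> 'I_m} | minper u == p]|.

Definition odd_primitive_words neg m p : nat :=
  #|[set u : {ffun 'I_p.-1.+1 -> 'I_m} | (minper u == p) && odd (neg_letters neg u p)]|.

(** A word is determined by its restriction to one minimal period, which is a
    primitive word. *)
Lemma card_minper (Q : pred nat) neg m n p : p.+1 %| n.+1 ->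
  #|[set w : {ffun 'I_n.+1 -> 'I_m} | (minper w == p.+1) && Q (neg_letters neg w p.+1)]|
  = #|[set u : {ffun 'I_p.+1 -> 'I_m} | (minper u == p.+1) && Q (neg_letters neg u p.+1)]|.
Proof.
move=> pn; pose ext (u : {ffun 'I_p.+1 -> 'I_m}) := [ffun i : 'I_n.+1 => u (inZp i)].
have letter_ext u k : letter (ext u) k = letter u k.
  rewrite /letter ffunE; congr (val (u _)); apply: val_inj.
  by rewrite /= modn_dvdm.
have minper_ext u : minper (ext u) = minper u.
  apply/eqP; rewrite eqn_dvd -!period_dvd; apply/andP; split; apply/periodP => k.
    by rewrite !letter_ext; apply/periodP; rewrite period_dvd.
  by rewrite -!letter_ext; apply/periodP; rewrite period_dvd.
have ext_inj : injective ext.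
  move=> u v uv; apply/ffunP => i; apply: val_inj.
  by rewrite /= -!letter_ord -!letter_ext uv.
rewrite -[RHS](card_imset _ ext_inj); apply: eq_card => w; rewrite inE.
have eq_neg_letters u : neg_letters neg (ext u) p.+1 = neg_letters neg u p.+1.
  by apply: eq_bigr => i _; rewrite letter_ext.
apply/idP/imsetP => [/andP[/eqP wp Qw]|[u]]; last first.
  by rewrite inE => + ->; rewrite minper_ext eq_neg_letters.
pose u := [ffun i : 'I_p.+1 => w (inZp i)].
have uw : w = ext u.
  apply/ffunP => i; apply: val_inj; rewrite !ffunE /= -letter_ord.
  rewrite -/(letter w (i %% p.+1)) {1}(divn_eq i p.+1) addnC.
  by apply/periodP; rewrite period_dvd wp dvdn_mull.
by exists u; rewrite // inE -minper_ext -eq_neg_letters -uw wp eqxx.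
Qed.

Lemma card_partition_seq (T : finType) (A : {set T}) (g : T -> nat) (s : seq nat) :
  uniq s -> {in A, forall x, g x \in s} ->
  #|A| = \sum_(d <- s) #|[set x in A | g x == d]|.
Proof.
move=> s_uniq gA; rewrite -sum1_card.
under [RHS]eq_bigr => d _ do rewrite -sum1dep_card big_mkcondr.
rewrite exchange_big /=; apply: eq_bigr => x xA.
rewrite -big_mkcond -big_filter /= (eq_filter (a2 := pred1 (g x))).
  by rewrite filter_pred1_uniq ?gA // big_seq1.
by move=> d; rewrite /= eq_sym.
Qed.

Section Counting.

Variables (neg : pred nat) (m : nat).

Definition odd_words n : nat :=
  #|[set w : {ffun 'I_n.+1 -> 'I_m} | odd (neg_letters neg w n.+1)]|.

Lemma quotient_minper n (w : {ffun 'I_n.+1 -> 'I_m}) d : d \in divisors n.+1 ->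
  (n.+1 %/ minper w == d) = (minper w == n.+1 %/ d).
Proof.
rewrite -dvdn_divisors // => dn; have wn := minper_dvd w.
have d_gt0 : 0 < d by apply: dvdn_gt0 dn.
by rewrite [LHS]eq_sym !eqn_div ?minper_gt0 // mulnC.
Qed.

Lemma sum_primitive_words n : 0 < n ->
  \sum_(d <- divisors n) primitive_words m (n %/ d) = m ^ n.
Proof.
case: n => // n _.
have -> : m ^ n.+1 = #|[set: {ffun 'I_n.+1 -> 'I_m}]|.
  by rewrite cardsT card_ffun !card_ord.
rewrite (card_partition_seq (g := fun w => n.+1 %/ minper w) (divisors_uniq n.+1)).
  rewrite !big_seq; apply: eq_bigr => d dn.
  have dn' : d %| n.+1 by rewrite dvdn_divisors.
  have nd_gt0 : 0 < n.+1 %/ d by rewrite divn_gt0 ?(dvdn_gt0 _ dn') // dvdn_leq.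
  have dvd_nd : (n.+1 %/ d).-1.+1 %| n.+1 by rewrite prednK // dvdn_div.
  transitivity #|[set u : {ffun 'I_(n.+1 %/ d).-1.+1 -> 'I_m} |
      minper u == (n.+1 %/ d).-1.+1]|.
    by apply: eq_card => u; rewrite !inE [X in _ = (_ == X)]prednK.
  have := card_minper xpredT pred0 m dvd_nd.
  rewrite (eq_card (B := [set w in setT | n.+1 %/ minper w == d])) => [->|w].
    by apply: eq_card => u; rewrite !inE andbT.
  by rewrite !inE andbT prednK // quotient_minper.
by move=> w _; rewrite -dvdn_divisors // dvdn_div ?minper_dvd.
Qed.

Lemma neg_letters_mul n (w : {ffun 'I_n.+1 -> 'I_m}) p j : period w p ->
  neg_letters neg w (j * p) = j * neg_letters neg w p.
Proof.
move=> wp; elim: j => [|j IH]; first by rewrite !mul0n /neg_letters big_ord0.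
by rewrite !mulSn neg_lettersD // IH.
Qed.

(** A word made of [d] copies of a block has an odd number of negative letters
    exactly when [d] is odd and the block has an odd number of them. *)
Lemma sum_odd_primitive_words n : 0 < n ->
  \sum_(d <- divisors n | odd d) odd_primitive_words neg m (n %/ d) = odd_words n.-1.
Proof.
case: n => // n _; rewrite /odd_words /=.
rewrite (card_partition_seq (g := fun w => n.+1 %/ minper w) (divisors_uniq n.+1)).
  rewrite big_mkcond !big_seq; apply: eq_bigr => d dn.
  have dn' : d %| n.+1 by rewrite dvdn_divisors.
  have nd_gt0 : 0 < n.+1 %/ d by rewrite divn_gt0 ?(dvdn_gt0 _ dn') // dvdn_leq.
  have nE : n.+1 = d * (n.+1 %/ d) by rewrite mulnC divnK.
  have dvd_nd : (n.+1 %/ d).-1.+1 %| n.+1 by rewrite prednK // dvdn_div.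
  have := card_minper (fun q => odd d && odd q) neg m dvd_nd.
  rewrite (eq_card (B := [set w in [set w : {ffun 'I_n.+1 -> 'I_m} | odd (neg_letters neg w n.+1)]
      | n.+1 %/ minper w == d])) => [->|w].
    case: ifP => d_odd; last first.
      by apply/esym/eqP; rewrite cards_eq0; apply/eqP/setP => w; rewrite !inE andbF.
    by apply: eq_card => u; rewrite !inE ![in RHS]prednK.
  rewrite !inE prednK // quotient_minper // andbC.
  have [wd|] := eqVneq (minper w); rewrite ?andbT ?andbF //=.
  rewrite [X in _ = odd (neg_letters _ _ X)]nE neg_letters_mul ?oddM //.
  by rewrite period_dvd wd.
by move=> w _; rewrite -dvdn_divisors // dvdn_div ?minper_dvd.
Qed.

Lemma sum_consistent n :
  \sum_(w : {ffun 'I_n.+1 -> 'I_m}) #|[set f | consistent neg w f]| =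
  primitive_words m n.+1 +
  (if odd n.+1 then 0 else (odd_primitive_words neg m n.+1./2).*2).
Proof.
rewrite (eq_bigr _ (fun w _ => card_consistent neg w)) big_split /=; congr (_ + _).
  by rewrite /primitive_words -sum1dep_card [RHS]big_mkcond; apply: eq_bigr => w _; case: eqP.
case: ifP => n_odd.
  rewrite big1 // => w _; have -> : ((minper w).*2 == n.+1) = false; last by [].
  by apply/eqP => /(congr1 odd); rewrite odd_double /= n_odd.
have nE : n.+1./2.*2 = n.+1 by rewrite -[RHS]odd_double_half /= n_odd.
have n2_gt0 : 0 < n.+1./2 by lia.
transitivity (#|[set w : {ffun 'I_n.+1 -> 'I_m} | (minper w == (n.+1./2).-1.+1)
      && odd (neg_letters neg w n.+1./2.-1.+1)]|.*2).
  rewrite -sum1dep_card -mul2n big_distrr [RHS]big_mkcond; apply: eq_bigr => w _ /=.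
  rewrite prednK // -[X in _.*2 == X]nE (inj_eq double_inj).
  by have [->|] := eqVneq (minper w); [case: odd | ].
rewrite (card_minper odd); last by rewrite prednK // -{2}nE -mul2n dvdn_mull.
by congr _.*2; apply: eq_card => u; rewrite !inE !prednK.
Qed.

End Counting.

(** The signed count of all words is the n-th power of the alternating sum of the
    letters, which is 1 or 0 according to the parity of [m]. *)
Lemma odd_words_total m n : (odd_words odd m n).*2 + odd m = m ^ n.+1.
Proof.
have alt : (\sum_(x < m) (-1) ^+ x = (odd m)%:R :> int)%R.
  elim: m => [|m IH]; first by rewrite big_ord0.
  by rewrite big_ord_recr /= IH -signr_odd; case: (odd m).
have : (\sum_(w : {ffun 'I_n.+1 -> 'I_m}) (-1) ^+ (neg_letters odd w n.+1) = (odd m)%:R :> int)%R.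
  transitivity (\prod_(i < n.+1) \sum_(x < m) (-1) ^+ x : int)%R.
    rewrite bigA_distr_bigA /=; apply: eq_bigr => w _.
    rewrite /neg_letters expr_sum; apply: eq_bigr => i _.
    by rewrite letter_ord signr_odd.
  by rewrite alt prodr_const card_ord -natrX; case: (odd m); rewrite ?exp1n // exp0n.
have cardW : m ^ n.+1 = #|{ffun 'I_n.+1 -> 'I_m}| by rewrite card_ffun !card_ord.
move=> sgn; apply/eqP; rewrite -(Num.Theory.eqr_nat int) natrD -sgn cardW -sum1_card natr_sum.
rewrite -mul2n natrM /odd_words -sum1dep_card natr_sum mulr_sumr big_mkcond -big_split /=.
apply/eqP; apply: eq_bigr => w _; rewrite -signr_odd.
by case: (odd _).
Qed.

(** The number of pairs of a circular word of length [n] and an order consistent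
    with it; see [sum_consistent]. *)
Definition cyclic_fits_count m n : nat := primitive_words m n +
  (if odd n then 0 else (odd_primitive_words odd m n./2).*2).

Lemma perm_even_divisors n : 0 < n -> ~~ odd n ->
  perm_eq [seq d <- divisors n | ~~ odd d] [seq d.*2 | d <- divisors n./2].
Proof.
move=> n_gt0 n_even; have nE : n./2.*2 = n by rewrite -[RHS]odd_double_half (negPf n_even).
have n2_gt0 : 0 < n./2 by lia.
apply: uniq_perm.
- by rewrite filter_uniq ?divisors_uniq.
- by rewrite map_inj_uniq ?divisors_uniq //; exact: double_inj.
move=> d; rewrite mem_filter -dvdn_divisors //; apply/andP/mapP => [[d_even dn]|[e]].
  have dE : d = d./2.*2 by rewrite -[LHS]odd_double_half (negPf d_even).
  exists d./2 => //; rewrite -dvdn_divisors //.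
  by move: dn; rewrite dE -nE -!mul2n dvdn_pmul2l // !mul2n !doubleK.
rewrite -dvdn_divisors // => en ->; rewrite odd_double; split=> //.
by rewrite -nE -!mul2n dvdn_pmul2l.
Qed.

Lemma perm_odd_divisors n : 0 < n -> ~~ odd n ->
  perm_eq [seq d <- divisors n | odd d] [seq d <- divisors n./2 | odd d].
Proof.
move=> n_gt0 n_even; have nE : n = 2 * n./2 by rewrite mul2n -[LHS]odd_double_half (negPf n_even).
have n2_gt0 : 0 < n./2 by lia.
apply: uniq_perm; rewrite ?filter_uniq ?divisors_uniq // => d.
rewrite !mem_filter -!dvdn_divisors //; case d_odd: (odd d) => //=.
by rewrite {1}nE Gauss_dvdr // coprimen2.
Qed.

(** Words of even length that repeat their primitive block an even number of times
    are the squares, as many as words of half the length. The doubled count of words of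
    half the length with an odd number of negative letters makes up for them, up
    to the defect in [odd_words_total]. *)
Lemma sum_cyclic_fits_count m n : 0 < n ->
  \sum_(d <- divisors n | odd d) cyclic_fits_count m (n %/ d) + (~~ odd n) * odd m = m ^ n.
Proof.
move=> n_gt0; rewrite big_split /=; have [n_odd|n_even] := boolP (odd n).
  rewrite /= mul0n addn0 [X in _ + X]big1_seq ?addn0; last first.
    move=> d /andP[_]; rewrite -dvdn_divisors // => dn.
    by rewrite (dvdn_odd (dvdn_div dn)).
  rewrite -(sum_primitive_words m n_gt0) [RHS]big_seq [LHS]big_seq_cond; apply: eq_bigl => d.
  rewrite -dvdn_divisors //; case dn: (d %| n) => //=.
  by rewrite (dvdn_odd dn).
have nE : n = 2 * n./2 by rewrite mul2n -[LHS]odd_double_half (negPf n_even).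
have n2_gt0 : 0 < n./2 by lia.
rewrite /= mul1n.
have -> : \sum_(d <- divisors n | odd d)
     (if odd (n %/ d) then 0 else (odd_primitive_words odd m (n %/ d)./2).*2)
   = (odd_words odd m n./2.-1).*2.
  rewrite -sum_odd_primitive_words // -mul2n big_distrr -[LHS]big_filter -[RHS]big_filter.
  rewrite (perm_big _ (perm_odd_divisors n_gt0 n_even)) /= !big_filter.
  rewrite big_seq_cond [RHS]big_seq_cond.
  apply: eq_bigr => d /andP[]; rewrite -dvdn_divisors // => dn d_odd.
  by rewrite {1 2}nE -muln_divA // mul2n odd_double doubleK -mul2n.
rewrite -addnA odd_words_total prednK //.
rewrite -(sum_primitive_words m n_gt0) [RHS](bigID odd) /=; congr (_ + _).
rewrite -(sum_primitive_words m n2_gt0) -[RHS]big_filter.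
rewrite (perm_big _ (perm_even_divisors n_gt0 n_even)) big_map.
by apply: eq_bigr => d _; rewrite {2}nE -mul2n divnMl.
Qed.

(** * Moebius inversion over odd divisors *)

Lemma mobius_mul_prime p e : prime p -> 0 < e ->
  mobius (p * e) = (if (p %| e)%N then 0 else - mobius e)%R.
Proof.
move=> p_pr e_gt0; have p_gt0 := prime_gt0 p_pr.
have pe_gt0 : 0 < p * e by rewrite muln_gt0 p_gt0.
have mem_pe q : (q \in primes (p * e)) = (q == p) || (q \in primes e).
  by rewrite primesM // primes_prime // inE.
have logn_pe q : logn q (p * e) = (q == p) + logn q e.
  by rewrite lognM // logn_prime // eq_sym.
rewrite /mobius pe_gt0 e_gt0 /=; case pe: (p %| e).
  case: ifP => // /allP all1; have := all1 p; rewrite mem_pe eqxx => /(_ isT).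
  by rewrite logn_pe eqxx -[logn p e]prednK // logn_gt0 mem_primes p_pr e_gt0.
have perm_pe : perm_eq (primes (p * e)) (p :: primes e).
  apply: uniq_perm => [||q]; rewrite ?primes_uniq //= ?inE ?mem_pe //.
  by rewrite primes_uniq mem_primes pe !andbF.
rewrite (perm_all _ perm_pe) (perm_size perm_pe) /= exprS mulN1r.
rewrite logn_pe eqxx (_ : logn p e = 0) /=; last first.
  by apply/eqP; rewrite -leqn0 leqNgt logn_gt0 mem_primes pe !andbF.
rewrite (_ : all _ _ = all (fun q => logn q e == 1) (primes e)).
  by case: all; rewrite ?oppr0.
apply: eq_in_all => q; rewrite logn_pe; have [->|//] := eqVneq q p.
by rewrite mem_primes pe !andbF.
Qed.

(** The divisors prime to the smallest prime factor cancel with their multiples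
    by this prime; further multiples have a square factor. *)
Lemma sum_mobius n : 0 < n -> (\sum_(d <- divisors n) mobius d = (n == 1)%:R)%R.
Proof.
move=> n_gt0; have [->|n_neq1] := eqVneq n 1; first by rewrite big_seq1.
have n_gt1 : 1 < n by rewrite ltn_neqAle eq_sym n_neq1.
pose p := pdiv n; have p_pr : prime p := pdiv_prime n_gt1.
have [k nE] : exists k, n = p * k.
  by exists (n %/ p); rewrite mulnC divnK // pdiv_dvd.
have k_gt0 : 0 < k by move: n_gt0; rewrite nE muln_gt0 => /andP[].
have p_gt0 := prime_gt0 p_pr.
rewrite (bigID (dvdn p)) /= -big_filter.
have eq_div : perm_eq [seq d <- divisors n | p %| d] [seq p * e | e <- divisors k].
  apply: uniq_perm; rewrite ?filter_uniq ?divisors_uniq //.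
    by rewrite map_inj_uniq ?divisors_uniq // => x y /eqP; rewrite eqn_pmul2l // => /eqP.
  move=> d; rewrite mem_filter -dvdn_divisors //.
  apply/andP/mapP => [[/dvdnP[e ->]]|[e]].
    by rewrite nE mulnC dvdn_pmul2l // => ek; exists e; rewrite -?dvdn_divisors // mulnC.
  by rewrite -dvdn_divisors // => ek ->; rewrite dvdn_mulr // nE dvdn_pmul2l.
rewrite (perm_big _ eq_div) big_map {eq_div} /=.
rewrite (eq_big_seq (fun e => if ~~ (p %| e)%N then - mobius e else 0)%R); last first.
  move=> e; rewrite -dvdn_divisors // => ek.
  by rewrite mobius_mul_prime ?(dvdn_gt0 _ ek) // if_neg.
rewrite -big_mkcond sumrN -[X in (_ + X)%R]big_filter.
have eq_div : perm_eq [seq d <- divisors n | ~~ (p %| d)] [seq d <- divisors k | ~~ (p %| d)].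
  apply: uniq_perm; rewrite ?filter_uniq ?divisors_uniq // => d.
  rewrite !mem_filter -!dvdn_divisors //; case pd: (p %| d) => //=.
  by rewrite nE Gauss_dvdr // coprime_sym prime_coprime // pd.
by rewrite (perm_big _ eq_div) big_filter addNr.
Qed.

Lemma sum_odd_divisors_multiple (f : nat -> int) n d : 0 < n -> d %| n -> odd d ->
  (\sum_(e <- divisors (n %/ d) | odd e) f (n %/ d %/ e)%N =
   \sum_(D <- divisors n | odd D && (d %| D)%N) f (n %/ D)%N)%R.
Proof.
move=> n_gt0 dn d_odd; have d_gt0 : 0 < d by apply: dvdn_gt0 dn.
have nd_gt0 : 0 < n %/ d by rewrite divn_gt0 // dvdn_leq.
have nE : n = d * (n %/ d) by rewrite mulnC divnK.
rewrite -[RHS]big_filter -[LHS]big_filter.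
have eq_div : perm_eq [seq D <- divisors n | odd D && (d %| D)]
    [seq d * e | e <- [seq e <- divisors (n %/ d) | odd e]].
  apply: uniq_perm; rewrite ?filter_uniq ?divisors_uniq //.
    rewrite map_inj_uniq ?filter_uniq ?divisors_uniq // => x y /eqP.
    by rewrite eqn_pmul2l // => /eqP.
  move=> D; rewrite mem_filter -dvdn_divisors //.
  apply/andP/mapP => [[/andP[D_odd /dvdnP[e DE]] Dn]|[e]].
    have en : e %| n %/ d by rewrite -(dvdn_pmul2l d_gt0) -nE mulnC -DE.
    exists e; last by rewrite mulnC.
    by rewrite mem_filter -dvdn_divisors // en andbT; move: D_odd; rewrite DE oddM => /andP[].
  rewrite mem_filter -dvdn_divisors // => /andP[e_odd en] ->.
  by rewrite oddM d_odd e_odd dvdn_mulr // nE dvdn_pmul2l.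
by rewrite (perm_big _ eq_div) big_map; apply: eq_bigr => e _; rewrite divnMA.
Qed.

(** Moebius inversion in the divisor lattice restricted to odd divisors. *)
Lemma odd_mobius_inversion (f : nat -> int) n : 0 < n ->
  (\sum_(d <- divisors n | odd d)
     mobius d * \sum_(e <- divisors (n %/ d) | odd e) f (n %/ d %/ e)%N = f n)%R.
Proof.
move=> n_gt0.
transitivity (\sum_(d <- divisors n | odd d) \sum_(D <- divisors n | odd D)
   (if (d %| D)%N then mobius d * f (n %/ D)%N else 0) : int)%R.
  rewrite big_seq_cond [RHS]big_seq_cond; apply: eq_bigr => d /andP[].
  rewrite -dvdn_divisors // => dn d_odd.
  by rewrite sum_odd_divisors_multiple // mulr_sumr big_mkcondr.
rewrite exchange_big /= big_seq_cond.
rewrite (eq_bigr (fun D => (D == 1)%:R * f (n %/ D)%N)%R) => [|D /andP[]]; last first.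
  rewrite -dvdn_divisors // => Dn D_odd; have D_gt0 : 0 < D by apply: dvdn_gt0 Dn.
  rewrite -sum_mobius // mulr_suml -big_mkcondr -big_filter.
  have eq_div : perm_eq [seq d <- divisors n | odd d && (d %| D)] (divisors D).
    apply: uniq_perm; rewrite ?filter_uniq ?divisors_uniq // => d.
    rewrite mem_filter -!dvdn_divisors //; case dD: (d %| D); rewrite ?andbF //=.
    by rewrite (dvdn_odd dD) // (dvdn_trans dD).
  by rewrite (perm_big _ eq_div).
rewrite -big_seq_cond (big_rem 1) -?dvdn_divisors //= divn1 mul1r.
rewrite big1_seq ?addr0 // => D /andP[_].
by rewrite mem_rem_uniq ?divisors_uniq // inE => /andP[/negPf -> _]; rewrite mul0r.
Qed.

Lemma odd_divisors_pow2 n : pow2 n -> [seq d <- divisors n | odd d] = [:: 1].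
Proof.
case=> k ->; apply: perm_small_eq => //.
apply: uniq_perm; rewrite ?filter_uniq ?divisors_uniq // => d.
rewrite mem_filter -dvdn_divisors ?expn_gt0 // inE.
apply/andP/eqP => [[d_odd]|->]; last by rewrite dvd1n.
by move=> /(dvdn_pfactor _ _ (isT : prime 2))[[|j] _ dE] //; rewrite dE expnS oddM in d_odd.
Qed.

(** The odd divisors of [n] are the divisors of its odd part, which differs from
    1 here. *)
Lemma sum_mobius_odd_divisors n : 0 < n -> ~ pow2 n ->
  (\sum_(d <- divisors n | odd d) mobius d = 0)%R.
Proof.
move=> n_gt0 n_pow2; have [r co_r nE] := pfactor_coprime (isT : prime 2) n_gt0.
have r_gt0 : 0 < r by move: n_gt0; rewrite nE muln_gt0 => /andP[].
have r_odd : odd r by rewrite -coprime2n.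
rewrite -big_filter; have eq_div : perm_eq [seq d <- divisors n | odd d] (divisors r).
  apply: uniq_perm; rewrite ?filter_uniq ?divisors_uniq // => d.
  rewrite mem_filter -!dvdn_divisors //; apply/andP/idP => [[d_odd]|dr].
    by rewrite nE Gauss_dvdl // coprimeXr // coprimen2.
  by rewrite (dvdn_odd dr) // nE dvdn_mulr.
rewrite (perm_big _ eq_div) sum_mobius //; case: eqP => // r1; case: n_pow2.
by exists (logn 2 n); rewrite {1}nE r1 mul1n.
Qed.

Lemma cyclic_fits_count_pow2 m n : 2 <= n -> pow2 n ->
  cyclic_fits_count m n + odd m = m ^ n.
Proof.
move=> n_gt1 n_pow2; have n_even : ~~ odd n.
  by case: n_pow2 n_gt1 => -[|k] -> //; rewrite expnS oddM.
rewrite -(sum_cyclic_fits_count m (ltnW n_gt1)) n_even mul1n.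
by rewrite -big_filter (odd_divisors_pow2 n_pow2) big_seq1 divn1.
Qed.

(** For odd [d] the number n/d has the parity of [n], so the correction term of
    [sum_cyclic_fits_count] is the same for all odd divisors and is cancelled by
    [sum_mobius_odd_divisors]. *)
Lemma cyclic_fits_count_mobius m n : 0 < n -> ~ pow2 n ->
  ((cyclic_fits_count m n)%:R =
   \sum_(d <- divisors n | odd d) mobius d * (m ^ (n %/ d))%:R :> int)%R.
Proof.
move=> n_gt0 n_pow2.
rewrite -(odd_mobius_inversion (fun j => (cyclic_fits_count m j)%:R)%R n_gt0).
apply/eqP; rewrite -subr_eq0 -sumrB.
rewrite big_seq_cond (eq_bigr (fun d => mobius d * - (~~ odd n * odd m)%:R)%R).
  by rewrite -big_seq_cond -mulr_suml sum_mobius_odd_divisors // mul0r.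
move=> d /andP[]; rewrite -dvdn_divisors // => dn d_odd.
have nd_gt0 : 0 < n %/ d by rewrite divn_gt0 ?(dvdn_gt0 _ dn) // dvdn_leq.
rewrite -mulrBr -(sum_cyclic_fits_count m nd_gt0) natrD natr_sum opprD addNKr.
by rewrite -{2}(divnK dn) oddM d_odd andbT.
Qed.

(** * Generating functions and the formula *)

Section PolynomialIdentities.

Local Open Scope ring_scope.

Variable R : comNzRingType.

(** This is the identity of Carlitz and Worpitzky. *)
Lemma mulps_eulerian j :
  mulps ((1 - 'X) ^+ j.+2) (fun k => (k ^ j.+1)%:R) =1 fun k => (eulerian R j.+1)`_k.
Proof.
move=> k; rewrite /eulerian coef_sum.
rewrite (eq_mulps _ (c' := fun k => \sum_(s : 'S_j.+1) total_series R pred0 (rev (ascents s)) k)).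
  rewrite mulps_sumr; apply: eq_bigr => s _.
  have := total_series_pos R (rev (ascents s)) k.
  by rewrite size_rev size_mkseq des_count.
move=> {}k; rewrite -sum_card_fits_pos natr_sum; apply: eq_bigr => s _.
by rewrite card_fits.
Qed.

(** For even indices 2k the terms are 2^j k^j, for odd ones (2k+1)^j. *)
Lemma mulps_power j : (0 < j)%N ->
  mulps ((1 - 'X^2) ^+ j.+1) (fun k => (k ^ j)%:R) =1
  fun k => (2 ^+ j *: (eulerian R j \Po 'X^2) + 'X * (typeB_eulerian R j \Po 'X^2))`_k.
Proof.
case: j => // j _ k.
have -> : (1 - 'X^2 : {poly R}) ^+ j.+2 = (1 - 'X) ^+ j.+2 \Po 'X^2.
  by rewrite rmorphXn rmorphB /= comp_polyX rmorph1.
rewrite mulps_comp_sqr coefD coefZ coefXM !coef_comp_poly_Xn // !dvdn2 !divn2.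
case k_odd: (odd k) => /=.
  case: k k_odd => //= k k_even; rewrite k_even mulr0 add0r coef_typeB_eulerian.
  rewrite (_ : uphalf k = k./2); last by rewrite uphalf_half (negPf k_even).
  by apply: eq_bigr => i _; rewrite addn1.
rewrite (eq_mulps _ (c' := fun i => 2 ^+ j.+1 * (i ^ j.+1)%:R)); last first.
  by move=> i; rewrite addn0 -mul2n expnMn natrM natrX.
rewrite mulpsZ mulps_eulerian; case: k k_odd => [|k] /=; first by rewrite addr0.
by move=> /negbFE ->; rewrite addr0.
Qed.

Lemma mulps_odd n :
  mulps ((1 - 'X^2) ^+ n.+1) (fun k => (odd k)%:R : R) =1
  fun k => ('X * (1 - 'X^2) ^+ n)`_k.
Proof.
move=> k; rewrite exprSr mulpsM mulrC -mulps_poly; apply: eq_mulps => {}k.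
rewrite mulpsB mul1ps mulpsXn coefX; case: k => [|[|k]] /=; rewrite ?subr0 //.
by rewrite subn2 /= negbK subrr.
Qed.

Lemma mulps_cyclic_fits k m :
  mulps ((1 - 'X^2) ^+ k.+3) (fun m => (cyclic_fits_count m k.+2)%:R : R) m *+ 2 =
  (k.+2%:R *: ((1 + 'X) ^+ 2 * \sum_(s : 'S_k.+2 | cyclic_perm s)
      (2 * 'X) ^+ udr s * (1 + 'X^2) ^+ (k.+2 - udr s)))`_m.
Proof.
rewrite (eq_mulps _ (c' := fun m => k.+2%:R * \sum_(s : 'S_k.+2 | cyclic_perm s)
    total_series R odd (rev (ascents s)) m)) => [|{}m]; last first.
  rewrite /cyclic_fits_count -sum_consistent -sum_cyclic_fits natrM natr_sum; congr (_ * _).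
  by apply: eq_bigr => s _; rewrite card_fits.
rewrite mulpsZ mulps_sumr coefZ -mulrnAr; congr (_ * _).
rewrite mulr_sumr coef_sum -sumrMnl.
apply: eq_bigr => s _; have ch := changes_size (rev (ascents s)).
have := total_series_odd R (rev (ascents s)) m; rewrite size_rev size_mkseq in ch *.
move=> ->; rewrite udr_changes subSS -coefMn.
apply: (congr1 (fun p : {poly R} => p`_m)).
by rewrite (exprS (2 * 'X)); ring.
Qed.

End PolynomialIdentities.

Local Open Scope ring_scope.

Lemma cyclic_udr_poly_eval (F : fieldType) n (t : F) : 1 + t ^+ 2 != 0 ->
  (cyclic_udr_poly F n.+2).[2 * t / (1 + t ^+ 2)] * (1 + t ^+ 2) ^+ n.+2 =
  \sum_(s : 'S_n.+2 | cyclic_perm s) (2 * t) ^+ udr s * (1 + t ^+ 2) ^+ (n.+2 - udr s).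
Proof.
move=> t2; rewrite /cyclic_udr_poly horner_sum mulr_suml; apply: eq_bigr => s _.
have udr_n : (udr s <= n.+2)%N.
  have := changes_size (rev (ascents s)).
  by rewrite udr_changes size_rev size_mkseq.
have -> : (1 + t ^+ 2) ^+ n.+2 = (1 + t ^+ 2) ^+ udr s * (1 + t ^+ 2) ^+ (n.+2 - udr s).
  by rewrite -exprD subnKC.
by rewrite hornerXn expr_div_n mulrA divfK // expf_neq0.
Qed.

Lemma cyclic_udr_poly_from_counts (F : fieldType) n (Q : {poly F}) (t : F) :
  [pchar F] =i pred0 -> 1 + t != 0 -> 1 + t ^+ 2 != 0 ->
  (forall m, mulps ((1 - 'X^2) ^+ n.+3) (fun k => (cyclic_fits_count k n.+2)%:R) m = Q`_m) ->
  (cyclic_udr_poly F n.+2).[2 * t / (1 + t ^+ 2)] =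
  2 / (n.+2%:R * (1 + t ^+ 2) ^+ n.+2 * (1 + t) ^+ 2) * Q.[t].
Proof.
move=> /pcharf0P F0 t1 t2 QE.
have n_neq0 : n.+2%:R != 0 :> F by rewrite F0.
have Q2 : Q *+ 2 = n.+2%:R *: ((1 + 'X) ^+ 2 * \sum_(s : 'S_n.+2 | cyclic_perm s)
      (2 * 'X) ^+ udr s * (1 + 'X^2) ^+ (n.+2 - udr s)).
  by apply/polyP => m; rewrite -mulps_cyclic_fits coefMn QE.
have := congr1 (horner^~ t) Q2; rewrite hornerMn hornerZ hornerM.
rewrite horner_sum.
rewrite (eq_bigr (fun s : 'S_n.+2 =>
  (2 * t) ^+ udr s * (1 + t ^+ 2) ^+ (n.+2 - udr s))); last first.
  move=> s _; by rewrite !(hornerM, horner_exp, hornerD, hornerX, hornerMn, hornerC).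
rewrite -cyclic_udr_poly_eval // horner_exp hornerD hornerX hornerC => EQ.
have c_neq0 : n.+2%:R * (1 + t ^+ 2) ^+ n.+2 * (1 + t) ^+ 2 != 0.
  exact: mulf_neq0 (mulf_neq0 n_neq0 (expf_neq0 _ t2)) (expf_neq0 _ t1).
apply: (mulfI c_neq0); rewrite [RHS]mulrA [X in _ = X * _]mulrC divfK // [RHS]mulr_natl EQ; ring.
Qed.

Theorem theorem4p10 (F : fieldType) (hF : [pchar F] =i pred0)
    (n : nat) (hn : (2 <= n)%N) (t : F)
    (ht1 : 1 + t != 0) (ht2 : 1 + t ^+ 2 != 0) :
  (pow2 n ->
     (cyclic_udr_poly F n).[2 * t / (1 + t ^+ 2)] =
     2 / (n%:R * (1 + t ^+ 2) ^+ n * (1 + t) ^+ 2) *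
       (2 ^+ n * (eulerian F n).[t ^+ 2] + t * (typeB_eulerian F n).[t ^+ 2]
        - t * (1 - t ^+ 2) ^+ n))
  /\
  (~ pow2 n ->
     (cyclic_udr_poly F n).[2 * t / (1 + t ^+ 2)] =
     2 / (n%:R * (1 + t ^+ 2) ^+ n * (1 + t) ^+ 2) *
       \sum_(d <- divisors n | odd d)
         (mobius d)%:~R * (1 - t ^+ 2) ^+ (n - n %/ d) *
           (2 ^+ (n %/ d) * (eulerian F (n %/ d)).[t ^+ 2]
            + t * (typeB_eulerian F (n %/ d)).[t ^+ 2])).
Proof.
case: n hn => [|[|n]] // hn.
pose E j : {poly F} := 2 ^+ j *: (eulerian F j \Po 'X^2) + 'X * (typeB_eulerian F j \Po 'X^2).
have E_t j : (E j).[t] = 2 ^+ j * (eulerian F j).[t ^+ 2] + t * (typeB_eulerian F j).[t ^+ 2].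
  by rewrite hornerD hornerZ hornerM !horner_comp hornerX hornerXn.
split=> n_pow2.
  rewrite (cyclic_udr_poly_from_counts (Q := E n.+2 - 'X * (1 - 'X^2) ^+ n.+2) hF ht1 ht2).
    by rewrite hornerD hornerN E_t hornerM horner_exp hornerD hornerN horner_exp !hornerX hornerC.
  move=> m; rewrite coefB -mulps_power // -mulps_odd; apply/eqP; rewrite eq_sym subr_eq.
  rewrite -big_split /=; apply/eqP; apply: eq_bigr => i _.
  by rewrite -mulrDr -natrD cyclic_fits_count_pow2.
rewrite (cyclic_udr_poly_from_counts (t := t)
  (Q := \sum_(d <- divisors n.+2 | odd d)
     (mobius d)%:~R *: ((1 - 'X^2) ^+ (n.+2 - n.+2 %/ d) * E (n.+2 %/ d)%N)) hF ht1 ht2).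
  congr (_ * _); rewrite horner_sum; apply: eq_bigr => d _.
  rewrite hornerZ hornerM E_t horner_exp hornerD hornerN horner_exp hornerX hornerC.
  by rewrite mulrA.
move=> m; rewrite coef_sum.
rewrite (eq_mulps _ (c' := fun k => \sum_(d <- divisors n.+2 | odd d)
   (mobius d)%:~R * (k ^ (n.+2 %/ d))%:R)); last first.
  move=> k; rewrite -[LHS](rmorph_nat (intmul 1)) cyclic_fits_count_mobius // rmorph_sum.
  by apply: eq_bigr => d _; rewrite rmorphM /= rmorph_nat.
rewrite mulps_sumr big_seq_cond [RHS]big_seq_cond; apply: eq_bigr => d /andP[].
rewrite -dvdn_divisors // => dn _; rewrite mulpsZ coefZ; congr (_ * _).
have nd_gt0 : (0 < n.+2 %/ d)%N by rewrite divn_gt0 ?(dvdn_gt0 _ dn) // dvdn_leq.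
rewrite -mulps_poly -(eq_mulps _ (mulps_power _ nd_gt0)) -mulpsM -exprD addnS subnK //.
exact: leq_div.
Qed.
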